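(* Let $\lambda>0$ and let $\mathcal{E}_M$ be a sequence of energies with $$\mathcal{E}=\lim_{M\to\infty}\mathcal{E}_M\in(-\lambda,\lambda)\setminus\{-1,0\}.$$ Then: (1) The rescaled eigenvalues $(u_{M,n})$ of $H_M$ coincide asymptotically, in probability, with the point process $(\omega_{M,n})$ of rescaled potential values, within windows of arbitrary fixed size: for every $W<\infty$ and $\varepsilon>0$, the probability that every $u_{M,n}\in[-W,W]$ lies within distance $\varepsilon$ of $\{\omega_{M,k}\}_k$ and every $\omega_{M,n}\in[-W,W]$ lies within distance $\varepsilon$ of $\{u_{M,k}\}_k$ tends to $1$ as $M\to\infty$. (2) For every $W<\infty$ and every $\gamma>0$, with probability tending to $1$ as $M\to\infty$, all the eigenfunctions $\psi_{M,n}$ corresponding to eigenvalues with $|u_{M,n}|<W$ satisfy $$1\le\frac{\|\psi_{M,n}\|_2}{\|\psi_{M,n}\|_\infty}\le1+\mathcal{O}\left(\frac1{M^{(\mathcal{E}/\lambda)^2(1-\gamma)}}\right)+\mathcal{O}\left(\frac1{M^{1/2-\gamma}}\right).$$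
   Context: Operator. For $M\ge2$ and $\lambda>0$, $\kappa_M:=\lambda/\sqrt{2\ln M}$ and $H_M:=-|\varphi_0\rangle\langle\varphi_0|+\kappa_M V$ is the random $M\times M$ matrix in which $\varphi_0=(1,\dots,1)/\sqrt{M}$ and $V$ is the diagonal matrix with i.i.d. standard Gaussian entries $V(1),\dots,V(M)$, with density $\varrho(v)=e^{-v^2/2}/\sqrt{2\pi}$. Scaling. $\Delta_M(\mathcal{E}):=\kappa_M/(M\varrho(\mathcal{E}/\kappa_M))=\sqrt{2\pi}\,\kappa_M/M^{1-(\mathcal{E}/\lambda)^2}$. For a given sequence $\mathcal{E}_M$ put $\Delta_M:=\Delta_M(\mathcal{E}_M)$. The rescaled potential values are the numbers $(\kappa_M V(x)-\mathcal{E}_M)/\Delta_M$, $x=1,\dots,M$, labeled in increasing order as $\dots\le\omega_{M,-1}\le\omega_{M,0}\le0<\omega_{M,1}<\dots$, with $x_m$ denoting the site corresponding to $\omega_{M,m}$. The rescaled eigenvalues are the numbers $(E-\mathcal{E}_M)/\Delta_M$ with $E$ an eigenvalue of $H_M$; almost surely they are simple and interlace with the $\omega_{M,n}$, and are labeled so that $\omega_{M,n-1}<u_{M,n}\le\omega_{M,n}$. The eigenfunction for $u_{M,n}$ is normalized as $\psi_{M,n}(x_m)=1/(\omega_{M,m}-u_{M,n})$. $\|\cdot\|_p$ is the $\ell^p$ norm over the $M$ sites. $f_M=\mathcal{O}(g_M)$ means that for some constant $C<\infty$, independent of the realization of the randomness and of $M$, $|f_M|\le C g_M$ for all sufficiently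 large $M$ except on events whose probability tends to $0$ as $M\to\infty$; here the constant is common to all eigenfunctions in the window. *)

(* Defs.v *)
From HB Require Import structures.
From mathcomp Require Import all_boot all_order all_algebra.
From mathcomp Require Import all_classical all_reals all_analysis.

Set Implicit Arguments.
Unset Strict Implicit.
Unset Printing Implicit Defensive.

Import Order.TTheory GRing.Theory Num.Theory.
Import numFieldNormedType.Exports.

Local Open Scope classical_set_scope.
Local Open Scope ring_scope.

Section Probability.
Context {R : realType}.

Definition mutually_independent d (T : measurableType d) (P : probability T R)
    (I : finType) (X : I -> {RV P >-> R}) : Prop :=
  forall (J : {set I}) (B : I -> set R),
    (forall i, measurable (B i)) ->
    P (\bigcap_(i in [set` J]) X i @^-1` B i) =
      (\prod_(i in J) P (X i @^-1` B i))%E.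

Definition standard_gaussian d (T : measurableType d) (P : probability T R)
    (X : {RV P >-> R}) : Prop :=
  forall B : set R, measurable B -> distribution P X B = normal_prob 0 1 B.

(* The value of a measure on a non-measurable set is meaningless in the
   library, so the event is only required to contain measurable events whose
   probability tends to 1. For measurable [A n] this is [P n (A n) --> 1]. *)
Definition with_probability_tending_to_1 (d : nat -> measure_display)
    (T : forall n, measurableType (d n)) (P : forall n, probability (T n) R)
    (A : forall n, set (T n)) : Prop :=
  exists B : forall n, set (T n),
    [/\ forall n, measurable (B n),
        forall n, B n `<=` A n &
        P n (B n) @[n --> \oo] --> 1%E].

End Probability.

(* [v : 'I_M -> R] is a realization of the potential and [e] stands for the
   reference energy (the paper's E_M). The index M ranges over nat; the values
   at M = 0, 1 are junk and are irrelevant in the limit of large M. *)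
Section Operator.
Context {R : realType}.
Variables (lambda : R) (M : nat).

Definition kappa : R := lambda / Num.sqrt (2 * ln M%:R).

Definition phi0 : 'cV[R]_M := const_mx (Num.sqrt M%:R)^-1.

Definition hamiltonian (v : 'I_M -> R) : 'M[R]_M :=
  - (phi0 *m phi0^T) + kappa *: diag_mx (\row_x v x).

Definition Delta (e : R) : R :=
  kappa / (M%:R * normal_pdf 0 1 (e / kappa)).

Definition rescale (e a : R) : R := (a - e) / Delta e.

(* The rescaled potential values are indexed here by the site x instead of by
   their rank m: [omega e v x_m] is omega_{M,m}. *)
Definition omega (e : R) (v : 'I_M -> R) (x : 'I_M) : R :=
  rescale e (kappa * v x).

Definition rescaled_potential_values (e : R) (v : 'I_M -> R) : set R :=
  range (omega e v).

Definition rescaled_eigenvalues (e : R) (v : 'I_M -> R) : set R :=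
  rescale e @` [set a | eigenvalue (hamiltonian v) a].

(* The vector with psi(x_m) = 1 / (omega_{M,m} - u). *)
Definition psi (e : R) (v : 'I_M -> R) (u : R) : 'rV[R]_M :=
  \row_x (1 / (omega e v x - u)).

(* Library eigenspaces consist of row vectors (left eigenvectors); this is
   immaterial since the Hamiltonian is symmetric. *)
Definition is_eigenfunction (v : 'I_M -> R) (a : R) (f : 'rV[R]_M) : Prop :=
  f != 0 /\ (f <= eigenspace (hamiltonian v) a)%MS.

Definition norm2 (f : 'rV[R]_M) : R := Num.sqrt (\sum_x f ord0 x ^+ 2).

(* [mx_norm] is the maximum of the absolute values of the entries. *)
Definition norm_infty (f : 'rV[R]_M) : R := mx_norm f.

End Operator.

Definition close_in_window {R : realType} (W eps : R) (U O : set R) : Prop :=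
  forall u, U u -> - W <= u <= W -> exists2 o, O o & `|u - o| <= eps.

(* Main.v *)
Require Import Defs.
From HB Require Import structures.
From mathcomp Require Import all_boot all_order all_algebra.
From mathcomp Require Import all_classical all_reals all_analysis.
From mathcomp Require Import measurable_realfun ring lra.

Set Implicit Arguments.
Unset Strict Implicit.
Unset Printing Implicit Defensive.

Import Order.TTheory GRing.Theory Num.Theory.
Import numFieldNormedType.Exports.

Local Open Scope classical_set_scope.
Local Open Scope ring_scope.

(* Eigenvectors of H_M not orthogonal to phi_0 are psi_u with the rescaled
   energy u solving the secular equation
     sum_x 1 / (omega_x - u) = Q,    Q = M Delta_M ~ M^((E/lambda)^2).
   Split the sum at |omega_x| <= L. Almost all sites have kappa_M V(x) close
   to 0, so the far part is (-1/E + small) Q with high probability, uniformly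
   in u in the window; hence the near sites, at most log M in number, must supply
   (1 + 1/E + small) Q, of order Q because E <> -1. This forces some omega_n
   within O(log M / Q) of u, and conversely the intermediate value theorem gives
   a root next to each omega_n because near values are separated by more than
   1 / log M. The remaining entries of psi_u satisfy
   sum_(x <> n) (omega_x - u)^-2 = O(Q), so relative to the n-th entry their
   squares sum to O((log M)^2 / Q), which is below M^-((E/lambda)^2 (1-gamma)).
   In particular the second error term of the theorem can be taken with
   constant 0. *)

(** * Events of high probability *)

Section HighProbability.
Context {R : realType} (d : nat -> measure_display).
Context (T : forall n, measurableType (d n)) (P : forall n, probability (T n) R).
Implicit Types A : forall n, set (T n).

(** The witness [B] may depend on [eps], and [A n] need not be measurable. The notion is thus stable
    under intersections and eventual inclusions, with no choice of a sequence of events until the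
    end. *)
Definition whp A := forall eps : R, 0 < eps -> \forall n \near \oo,
  exists B : set (T n),
    [/\ measurable B, B `<=` A n & (P n (~` B) <= eps%:E)%E].

Lemma whpI A (B : forall n, set (T n)) : whp A -> whp B -> whp (fun n => A n `&` B n).
Proof.
move=> hA hB eps e0; have e2 : 0 < eps / 2 by rewrite divr_gt0.
near=> n.
have [A' [mA' sA pA]] : exists A' : set (T n),
    [/\ measurable A', A' `<=` A n & (P n (~` A') <= (eps/2)%:E)%E].
  by near: n; exact: hA.
have [B' [mB' sB pB]] : exists B' : set (T n),
    [/\ measurable B', B' `<=` B n & (P n (~` B') <= (eps/2)%:E)%E].
  by near: n; exact: hB.
exists (A' `&` B'); split; first exact: measurableI.
  by move=> w [/sA ? /sB ?].
rewrite setCI; apply: le_trans (measureU2 _ (measurableC mA') (measurableC mB')) _.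
by rewrite [eps]splitr EFinD leeD.
Unshelve. all: by end_near. Qed.

Lemma whpS A (B : forall n, set (T n)) : (\forall n \near \oo, A n `<=` B n) -> whp A -> whp B.
Proof.
move=> AB hA eps e0; near=> n.
have [A' [mA' sA pA]] : exists A' : set (T n),
    [/\ measurable A', A' `<=` A n & (P n (~` A') <= eps%:E)%E].
  by near: n; exact: hA.
exists A'; split => //; apply: subset_trans sA _; near: n; exact: AB.
Unshelve. all: by end_near. Qed.

(** For each n, take a measurable subset of [A n] whose complement has probability within 1 / (n +
    1) of the infimum. This single sequence then serves every [eps]. *)
Lemma whp_tending_to_1 A : whp A -> with_probability_tending_to_1 P A.
Proof.
move=> hA.
pose good n : set (set (T n)) := [set B | measurable B /\ B `<=` A n].
pose S n := [set P n (~` B) | B in good n].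
have good0 n : good n set0 by split => //; exact: measurable0.
have Sfin n : ereal_inf (S n) \is a fin_num.
  rewrite ge0_fin_numE; last first.
    by apply: le_ereal_inf_tmp => _ [B _ <-]; exact: measure_ge0.
  apply: (@le_lt_trans _ _ (P n (~` set0))).
    by apply: ereal_inf_lbound; exists set0.
  by rewrite setC0 probability_setT ltry.
have choice n : exists B, good n B /\
    (P n (~` B) < ereal_inf (S n) + (n.+1%:R^-1)%:E)%E.
  have n0 : 0 < n.+1%:R^-1 :> R by rewrite invr_gt0.
  by have [_ [B gB <-] lt] := lb_ereal_inf_adherent n0 (Sfin n); exists B.
pose B n := projT1 (cid (choice n)).
have BP n : good n (B n) /\
    (P n (~` B n) < ereal_inf (S n) + (n.+1%:R^-1)%:E)%E.
  exact: (projT2 (cid (choice n))).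
exists B; split => [n|n|].
- by have [[]] := BP n.
- by have [[]] := BP n.
apply/fine_cvgP; split.
  near=> n; rewrite ge0_fin_numE ?measure_ge0//.
  by rewrite (le_lt_trans (probability_le1 _ _)) ?ltry//; have [[]] := BP n.
apply/cvgrPdist_le => eps e0; have e2 : 0 < eps / 2 by rewrite divr_gt0.
near=> n; have [[mB _] lt] := BP n.
have [C [mC sC pC]] : exists C : set (T n),
    [/\ measurable C, C `<=` A n & (P n (~` C) <= (eps/2)%:E)%E].
  by near: n; exact: hA.
have n2 : n.+1%:R^-1 <= eps / 2.
  by near: n; apply: filterS (near_infty_natSinv_lt (PosNum e2)) => n /= /ltW.
have : (P n (~` B n) <= eps%:E)%E.
  apply: (le_trans (ltW lt)); rewrite [eps]splitr EFinD leeD ?lee_fin//.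
  by apply: le_trans pC; apply: ereal_inf_lbound; exists C.
rewrite probability_setC//=.
have : P n (B n) \is a fin_num.
  rewrite ge0_fin_numE ?measure_ge0//.
  by rewrite (le_lt_trans (probability_le1 _ _)) ?ltry.
have : (P n (B n) <= 1)%E by exact: probability_le1.
case: (P n (B n)) => //= r; rewrite lee_fin => r1 _.
by rewrite -EFinB lee_fin => re; rewrite ger0_norm ?subr_ge0.
Unshelve. all: by end_near. Qed.

End HighProbability.

(** * Markov's inequality and Gaussian probabilities *)

Section Probability.
Context {R : realType} d (T : measurableType d) (P : probability T R).

(** Markov's inequality for the weighted count of the [A i], with the threshold normalised to 1.
    Every probabilistic estimate on the potential below reduces to this first-moment bound. *)
Lemma markov_indic (I : finType) (A : I -> set T) (c p : I -> R) :
  (forall i, measurable (A i)) -> (forall i, 0 <= c i) ->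
  (forall i, (P (A i) <= (p i)%:E)%E) ->
  exists B : set T, [/\ measurable B,
    B `<=` [set w | \sum_i c i * \1_(A i) w < 1] &
    (P (~` B) <= (\sum_i c i * p i)%:E)%E].
Proof.
move=> mA c0 pA.
pose g i w : \bar R := (c i * \1_(A i) w)%:E.
pose f w : \bar R := (\sum_(i <- index_enum I) g i w)%E.
have mc i : measurable_fun setT (g i).
  by apply/measurable_EFinP/measurable_funM => //; exact: measurable_indic.
have f0 i w : setT w -> (0 <= g i w)%E.
  by move=> _; rewrite lee_fin mulr_ge0.
have mf : measurable_fun setT f.
  by apply: emeasurable_sum => i; exact: mc.
pose C := [set w | (1 <= f w)%E].
have mC : measurable C.
  rewrite -[C]setTI; apply: emeasurable_fun_c_infty => //.
exists (~` C); split; first exact: measurableC.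
  move=> w /=; rewrite /C /= => /negP; rewrite -ltNge /f sumEFin lte_fin.
  by [].
rewrite setCK.
have -> : P C = (\int[P]_w (\1_C w)%:E)%E by rewrite integral_indic// setIT.
apply: (@le_trans _ _ (\int[P]_w f w)%E).
  apply: ge0_le_integral => //.
    by apply/measurable_EFinP; exact: measurable_indic.
  move=> w _; rewrite indicE; case: (boolP (w \in C)) => [|_].
    by rewrite inE.
  by apply: sume_ge0 => i _; exact: f0.
have -> : (\int[P]_w f w = \sum_(i <- index_enum I) \int[P]_w g i w)%E.
  exact: ge0_integral_sum.
rewrite -sumEFin; apply: lee_sum => i _.
rewrite [leLHS](_ : _ = (c i)%:E * \int[P]_w (\1_(A i) w)%:E)%E; last first.
  rewrite -ge0_integralZl_EFin//.
  by apply/measurable_EFinP; exact: measurable_indic.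
rewrite integral_indic// setIT EFinM; apply: lee_wpmul2l; last exact: pA.
by rewrite lee_fin.
Qed.

Lemma gaussian_small_ball (X : {RV P >-> R}) (s t c : R) :
  standard_gaussian X -> s <= t ->
  (forall v, s <= v <= t -> normal_pdf 0 1 v <= c) ->
  (P (X @^-1` `[s, t]) <= (c * (t - s))%:E)%E.
Proof.
move=> hX st hc.
have := hX _ (measurable_itv `[s, t]); rewrite /distribution /pushforward => ->.
rewrite /normal_prob.
apply: (@le_trans _ _ (\int[lebesgue_measure]_(x in `[s, t]) c%:E)%E).
  apply: ge0_le_integral => //.
  - by move=> x _; rewrite lee_fin normal_pdf_ge0.
  - by apply/measurable_funTS/measurable_EFinP; exact: measurable_normal_pdf.
rewrite integral_cst//= lebesgue_measure_itv/= lte_fin.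
case: ltP => [_|ts]; first by rewrite -EFinB -EFinM.
by rewrite mule0 (@le_anti _ _ s t) ?st// subrr mulr0.
Qed.

End Probability.

(** Continuity from below along the intervals [-n, n]. The bound [v0] is chosen before the
    probability space, because the space varies with M. *)
Lemma gaussian_tail {R : realType} (eps : R) : 0 < eps -> exists2 v0 : R, 0 < v0 &
  forall d (T : measurableType d) (P : probability T R) (X : {RV P >-> R}),
  standard_gaussian X -> forall v, v0 <= v -> (P (~` (X @^-1` `[(- v)%R, v])) <= eps%:E)%E.
Proof.
move=> e0; pose F n : set R := [set` `[- n%:R, n%:R]].
have mF n : measurable (F n) by exact: measurable_itv.
have FT : \bigcup_n F n = setT.
  apply/seteqP; split => // x _; exists (Num.truncn `|x|).+1 => //=.
  by rewrite /F /= in_itv /= -ler_norml ltW// truncnS_gt.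
have ndF : {homo F : n m / (n <= m)%N >-> (n <= m)%O}.
  move=> n m nm; apply/subsetPset => x; rewrite /F /= !in_itv /= -!ler_norml.
  by move=> /le_trans; apply; rewrite ler_nat.
have mFT : measurable (\bigcup_n F n) by rewrite FT.
pose N01 : probability (measurableTypeR R) R := normal_prob (0 : R) 1.
have : normal_prob (0 : R) 1 (F n) @[n --> \oo] --> 1%E.
  rewrite -(@probability_setT _ _ _ N01) -FT.
  exact: (@nondecreasing_cvg_mu _ _ R N01 F mF mFT ndF).
move=> /fine_cvgP[_ /cvgrPdist_le /(_ _ e0)].
case=> N _ /(_ N (leqnn _)) /= hN; exists N.+1%:R => // d T P X hX v v0.
rewrite preimage_setC.
have := hX _ (measurableC (measurable_itv `[-v, v])).
rewrite /distribution /pushforward => ->.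
apply: (@le_trans _ _ (normal_prob 0 1 (~` F N))).
  apply: le_measure; rewrite ?inE; try exact: measurableC.
    exact: measurableC (mF N).
  apply: subsetC => x; rewrite /F /= !in_itv /= -!ler_norml => /le_trans.
  by apply; rewrite (le_trans _ v0)// ler_nat.
rewrite (@probability_setC _ _ _ N01 _ (mF N)).
have := @probability_le1 _ _ _ N01 (F N) (mF N).
have := measure_ge0 N01 (F N); rewrite /N01 /=.
move: hN; case: (normal_prob 0 1 (F N)) => //= r.
by rewrite !lee_fin => hN r0 r1; rewrite (le_trans (ler_norm _) hN).
Qed.

(** * The secular equation *)

Section SecularEquation.
Context {R : realType}.
Variables (lambda : R) (M : nat) (e : R) (v : 'I_M -> R).
Local Notation kappa := (kappa lambda M).
Local Notation Delta := (Delta lambda M e).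
Local Notation omega := (omega lambda e v).

Lemma mulmx_hamiltonian (f : 'rV[R]_M) x :
  (f *m hamiltonian lambda v) ord0 x =
  kappa * v x * f ord0 x - (\sum_y f ord0 y) / M%:R.
Proof.
rewrite /hamiltonian mulmxDr mulmxN mxE [X in _ + X]mxE addrC; congr (_ + _).
  rewrite (bigD1 x)//= big1 => [|y yx].
    by rewrite !mxE eqxx mulr1n addr0; ring.
  by rewrite !mxE (negbTE yx) mulr0n mulr0 mulr0.
rewrite mxE; congr (- _); rewrite mulmxA mxE big_ord_recl big_ord0 addr0 !mxE.
under eq_bigr do rewrite !mxE.
by rewrite -mulr_suml -mulrA -expr2 exprVn sqr_sqrtr.
Qed.

Lemma rescaleK u : Delta != 0 -> rescale lambda M e (e + Delta * u) = u.
Proof. by move=> D0; rewrite /rescale; field. Qed.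

Lemma omega_sub a x : Delta != 0 ->
  kappa * v x - a = Delta * (omega x - rescale lambda M e a).
Proof. by move=> D0; rewrite /Defs.omega /rescale; field. Qed.

(** In the row at x the diagonal part of H - a contributes [Delta * (omega x - u) / (omega x - u) =
    Delta]. The rank-one part subtracts the mean of the entries, which the secular equation makes
    equal to [Delta] as well. *)
Lemma secular_eigenfunction a : (0 < M)%N -> Delta != 0 ->
  let u := rescale lambda M e a in
  (forall x, omega x != u) ->
  \sum_x 1 / (omega x - u) = M%:R * Delta ->
  is_eigenfunction lambda v a (psi lambda e v u).
Proof.
move=> M0 D0 /= hu hs; split.
  apply/negP => /eqP/rowP/(_ (Ordinal M0)); rewrite !mxE => /eqP.
  by rewrite mul1r invr_eq0 subr_eq0 (negbTE (hu _)).
apply/eigenspaceP/rowP => x; rewrite mulmx_hamiltonian !mxE.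
under eq_bigr do rewrite mxE.
rewrite hs; have M0' : M%:R != 0 :> R by rewrite pnatr_eq0 -lt0n.
have := omega_sub a x D0; set u := rescale _ _ _ _.
have : omega x - u != 0 by rewrite subr_eq0.
set z := omega x - u => z0 hz.
have -> : kappa * v x = Delta * z + a by rewrite -hz subrK.
by field; rewrite z0.
Qed.

Lemma eigenvalue_of_secular u : (0 < M)%N -> Delta != 0 ->
  (forall x, omega x != u) ->
  \sum_x 1 / (omega x - u) = M%:R * Delta ->
  rescaled_eigenvalues lambda e v u.
Proof.
move=> M0 D0 hu hs; exists (e + Delta * u); last exact: rescaleK.
have := @secular_eigenfunction (e + Delta * u) M0 D0; rewrite /= rescaleK//.
move=> /(_ hu hs) [f0 /eigenspaceP hf]; apply/eigenvalueP.
by exists (psi lambda e v u).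
Qed.

(** The injectivity assumption rules out eigenvectors f orthogonal to [phi0]: if the entries sum to
    0, then f vanishes wherever [omega x != u], hence at all but at most one site, and the zero sum
    kills that entry too. Once the sum is nonzero, the row equations determine f up to scale, and
    summing them gives the secular equation. *)
Lemma secular_of_eigenvalue a : (0 < M)%N -> Delta != 0 ->
  let u := rescale lambda M e a in
  (forall x y, omega x = u -> omega y = u -> x = y) ->
  eigenvalue (hamiltonian lambda v) a ->
  (forall x, omega x != u) /\ \sum_x 1 / (omega x - u) = M%:R * Delta.
Proof.
move=> M0 D0 /= hinj /eigenvalueP[f hf f0]; set u := rescale _ _ _ _ in hinj *.
have M0' : M%:R != 0 :> R by rewrite pnatr_eq0 -lt0n.
set s := \sum_y f ord0 y.
have hx x : Delta * (omega x - u) * f ord0 x = s / M%:R.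
  rewrite -omega_sub//; move/rowP/(_ x): hf; rewrite mulmx_hamiltonian !mxE.
  by rewrite -/s mulrBl => <-; ring.
have s0 : s != 0.
  apply/negP => /eqP s0; have hz x : omega x != u -> f ord0 x = 0.
    move=> xu; have := hx x; rewrite s0 mul0r => /eqP.
    rewrite mulf_eq0 => /orP[|/eqP//].
    by rewrite mulf_eq0 (negbTE D0) subr_eq0 (negbTE xu).
  move/negP: f0; apply; apply/eqP/rowP => x; rewrite mxE.
  have [xu|] := eqVneq (omega x) u; last exact: hz.
  rewrite -s0 /s (bigD1 x)//= big1 ?addr0// => y yx; apply: hz.
  by apply/negP => /eqP yu; move/negP: yx; apply; apply/eqP; exact: hinj.
have hu x : omega x != u.
  apply/negP => /eqP xu; have := hx x; rewrite xu subrr mulr0 mul0r.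
  by move/esym/eqP; rewrite mulf_eq0 invr_eq0 (negbTE s0) (negbTE M0').
split=> //; apply: (mulfI s0); rewrite mulr_sumr.
transitivity (\sum_x M%:R * Delta * f ord0 x); last first.
  by rewrite -mulr_sumr mulrC.
apply: eq_bigr => x _.
have -> : s = M%:R * (Delta * (omega x - u) * f ord0 x) by rewrite hx mulrC divfK.
have : omega x - u != 0 by rewrite subr_eq0.
set z := omega x - u => z0.
by field; rewrite z0.
Qed.

End SecularEquation.

(** * Roots of the secular equation and nearby poles *)

Section ResolventSum.
Context {R : realType} (I : finType).
(** In the application [delta] is 1 / ln M, [Q] is M times [Delta], and [g] is the fraction of [Q]
    that the far sites leave to be supplied by the near ones. *)
Variables (om : I -> R) (L delta g C Q W : R).
Local Notation near := (fun x => `|om x| <= L).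
Let far (u : R) := \sum_(x | ~~ near x) 1 / (om x - u).
Hypotheses (delta0 : 0 < delta) (delta1 : delta <= 1) (Q0 : 0 < Q).
Hypothesis (WL : W + 1 <= L).
Hypothesis (g0 : g != 0).
Hypothesis near_few : \sum_(x | near x) 1 <= delta^-1.
Hypothesis near_sep : forall x y, near x -> near y -> x != y ->
  delta < `|om x - om y|.
Hypothesis far_approx : forall u, `|u| <= W ->
  `|far u - (1 - g) * Q| <= `|g| / 2 * Q.
Hypothesis far_sqr : forall u, `|u| <= W ->
  \sum_(x | ~~ near x) (1 / (om x - u)) ^+ 2 <= C * Q.

Lemma resolvent_sum_split u :
  \sum_x 1 / (om x - u) = \sum_(x | near x) 1 / (om x - u) + far u.
Proof. by rewrite (bigID near). Qed.

Lemma near_sum_le (b : R) (F : I -> R) (A : pred I) : 0 <= b ->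
  (forall x, near x -> A x -> F x <= b) ->
  \sum_(x | near x && A x) F x <= b / delta.
Proof.
move=> b0 h; apply: (@le_trans _ _ (\sum_(x | near x) b)).
  rewrite big_mkcondr /=; apply: ler_sum => x xn.
  by case: ifP => // /(h _ xn).
rewrite -[b in leLHS]mulr1 -mulr_sumr.
exact: ler_wpM2l.
Qed.

(** The far sum deviates from (1 - g) Q by at most |g| Q / 2, so the near sum must have size at
    least |g| Q / 2. If all near sites were farther than the claimed bound t from u, their sum would
    be at most 1 / (t delta) = |g| Q / 4. *)
Lemma secular_root_close (u : R) : `|u| <= W ->
  \sum_x 1 / (om x - u) = Q ->
  exists2 n, near n & `|om n - u| <= 4 / (delta * `|g| * Q).
Proof.
move=> uW; rewrite resolvent_sum_split => hs.
have g0' : 0 < `|g| by rewrite normr_gt0.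
set t := 4 / _; have t0 : 0 < t by rewrite divr_gt0// !mulr_gt0.
apply: contrapT => hn.
have hfar x : near x -> t < `|om x - u|.
  by move=> xn; rewrite ltNge; apply/negP => xt; apply: hn; exists x.
have : `|\sum_(x | near x) 1 / (om x - u)| <= t^-1 / delta.
  apply: le_trans (ler_norm_sum _ _ _) _.
  rewrite (eq_bigl (fun x => near x && predT x)); last by move=> x; rewrite andbT.
  apply: near_sum_le; first by rewrite invr_ge0 ltW.
  move=> x /hfar xt _; rewrite mul1r normfV lef_pV2 ?posrE// ?ltW//.
  exact: lt_trans xt.
have -> : t^-1 / delta = `|g| / 4 * Q.
  by rewrite /t; field; rewrite !gt_eqF.
have := far_approx uW; set fu := far u in hs *; set nu := \sum_(x | _) _ in hs *.
have {hs} -> : fu = Q - nu by lra.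
move=> h1 h2; have h3 : `|g * Q| <= `|g| / 2 * Q + `|g| / 4 * Q.
  have -> : g * Q = Q - nu - (1 - g) * Q + nu by ring.
  exact: le_trans (ler_normD _ _) (lerD h1 h2).
move: h3; rewrite normrM (gtr0_norm Q0).
have := mulr_gt0 g0' Q0; lra.
Qed.

Lemma continuous_resolvent_sum (A : pred I) (p : R) :
  (forall x, A x -> om x != p) ->
  {for p, continuous (fun u => \sum_(x | A x) 1 / (om x - u))}.
Proof.
move=> hA; rewrite /continuous_at.
apply: (@cvg_big _ _ +%R) => [|x Ax]; first exact: add_continuous.
apply: cvgM; first exact: cvg_cst.
apply: cvgV; first by rewrite subr_eq0 hA.
by apply: cvgB; [exact: cvg_cst | exact: cvg_id].
Qed.

(** The pole at [om n] can supply the missing amount g Q: on one side of it, 1 / (om n - u) runs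
    through all large values of the sign of g. The lower bound on [Q] ensures that at distance
    [delta / 2] the near sum is still too small, so a root lies in between. *)
Lemma secular_root_exists (n : I) : `|om n| <= W - 1 -> 2 / delta ^+ 2 < `|g| / 2 * Q ->
  exists u, [/\ `|u - om n| <= delta / 2, forall x, om x != u &
    \sum_x 1 / (om x - u) = Q].
Proof.
move=> nW hQ.
have hWL := WL; have nn : `|om n| <= L by lra.
have hd1 := delta1; have d2 : 0 < delta / 2 by rewrite divr_gt0.
(* The starting point lies to the left of [om n] if g > 0 and to the right if g < 0, where the pole
   has the sign of g. The identity for [(p - om n) * g] treats both cases at once. *)
have [p [pn hp]] : exists p, `|p - om n| = delta / 2 /\
    (p - om n) * g = - (delta / 2) * `|g|.
  case: (ltrgt0P g) g0 => // hg _; [exists (om n - delta/2)|exists (om n + delta/2)].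
    split; last by ring.
    by rewrite addrC addKr normrN gtr0_norm.
  split; last by ring.
  by rewrite addrC addKr gtr0_norm.
(* For near x this is the separation hypothesis. A far x has |om x| > L >= W + 1 while |om n| <= W -
   1, so it is more than 2 away from [om n]. *)
have away u : `|u - om n| <= delta / 2 -> forall x, x != n -> delta / 2 <= `|om x - u|.
  move=> un x xn; case: (lerP `|om x| L) => hx.
    have := near_sep hx nn xn => h; have := ler_distD u (om x) (om n).
    move: h un; lra.
  have h1 := ler_distD u (om x) (om n); have h2 := lerB_dist (om x) (om n).
  move: h1 h2 un; lra.
have uW u : `|u - om n| <= delta / 2 -> `|u| <= W.
  by move=> h; have := lerB_dist u (om n); lra.
pose S u := \sum_(x | x != n) 1 / (om x - u).
(* [G] is the secular function minus [Q], multiplied by [om n - u] to remove its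
   pole at [om n]; it changes sign between [p] and [om n]. *)
pose G u := 1 + (om n - u) * (S u - Q).
have Gn : G (om n) = 1 by rewrite /G subrr mul0r addr0.
have split_n u : \sum_x 1 / (om x - u) = 1 / (om n - u) + S u.
  by rewrite (bigD1 n).
have pn0 : p - om n != 0 by rewrite -normr_gt0 pn.
have Gp : G p < 0.
  have -> : G p = (om n - p) * (\sum_x 1 / (om x - p) - Q).
    by rewrite split_n /G; field; rewrite -normr_gt0 distrC normr_gt0.
  have pd : `|p - om n| <= delta / 2 by rewrite pn.
  rewrite resolvent_sum_split.
  have h1 := far_approx (uW _ pd).
  have h2 : `|\sum_(x | near x) 1 / (om x - p)| <= 2 / delta ^+ 2.
    apply: le_trans (ler_norm_sum _ _ _) _.
    rewrite (eq_bigl (fun x => near x && predT x)); last by move=> x; rewrite andbT.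
    have -> : 2 / delta ^+ 2 = (delta / 2)^-1 / delta by field; rewrite gt_eqF.
    apply: near_sum_le; first by rewrite invr_ge0 ltW.
    move=> x xn _; rewrite mul1r normfV.
    have hx : delta / 2 <= `|om x - p|.
      have [->|] := eqVneq x n; first by rewrite distrC pn.
      exact: away.
    by rewrite lef_pV2 ?posrE//; apply: lt_le_trans hx.
  set nu := \sum_(x | _) _ in h2 *; set fu := far p in h1 *.
  (* The main term [(p - om n) * g * Q] equals - (delta / 2) |g| Q; the rest has strictly smaller
     absolute value, so [G p] is negative. *)
  have -> : (om n - p) * (nu + fu - Q) =
    (p - om n) * g * Q - (p - om n) * (nu + (fu - (1 - g) * Q)) by ring.
  rewrite hp; set z := nu + _.
  have hz : `|z| < `|g| * Q.
    by have := ler_normD nu (fu - (1 - g) * Q); rewrite -/z; lra.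
  have : `|(p - om n) * z| < delta / 2 * (`|g| * Q).
    by rewrite normrM pn ltr_pM2l.
  have := ler_norm (- ((p - om n) * z)); rewrite normrN; lra.
pose a := Num.min p (om n); pose b := Num.max p (om n).
have ab : a <= b by rewrite /a /b; case: (lerP p (om n)) => // /ltW.
have dist u : a <= u <= b -> `|u - om n| <= delta / 2.
  rewrite -pn /a /b; case: (lerP p (om n)) => h /andP[h1 h2].
    by rewrite ler_norml; lra.
  by rewrite ler_norml; lra.
have [||u uab Gu] := @IVT R G a b 0 ab.
- apply: continuous_in_subspaceT => u /[!(@mem_setE R)] /itvP uab.
  have hu : `|u - om n| <= delta / 2 by apply: dist; rewrite !uab.
  apply: cvgD; first exact: cvg_cst.
  apply: cvgM; first by apply: cvgB; [exact: cvg_cst | exact: cvg_id].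
  apply: cvgB; last exact: cvg_cst.
  apply: continuous_resolvent_sum => x /(away _ hu) h.
  by rewrite -subr_eq0 -normr_gt0 (lt_le_trans _ h).
- rewrite /a /b; case: (lerP p (om n)) => _; rewrite Gn.
    by rewrite ge_min le_max ler01 (ltW Gp) orbT.
  by rewrite ge_min le_max ler01 (ltW Gp) orbT.
have hu : `|u - om n| <= delta / 2 by apply: dist; move: uab; rewrite in_itv.
have nu : om n != u.
  by apply/eqP => nu; move/eqP: Gu; rewrite -nu Gn oner_eq0.
exists u; split => // [x|].
  have [->//|xn] := eqVneq x n.
  by rewrite -subr_eq0 -normr_gt0 (lt_le_trans _ (away _ hu _ xn)).
have nu0 : om n - u != 0 by rewrite subr_eq0.
rewrite split_n; move: Gu; rewrite /G => /eqP; rewrite addr_eq0 => /eqP Gu.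
rewrite Gu; field.
by [].
Qed.

(** Separation keeps every other near site at distance at least [delta / 2] from u, and there are at
    most 1 / delta of them, each contributing at most 4 / delta^2. *)
Lemma off_root_sqr_sum (u : R) (n : I) : near n -> `|u| <= W -> `|om n - u| <= delta / 2 ->
  \sum_(x | x != n) (1 / (om x - u)) ^+ 2 <= 4 / delta ^+ 3 + C * Q.
Proof.
move=> nn uW un; rewrite (bigID near) /=; apply: lerD; last first.
  apply: le_trans (far_sqr uW); rewrite [leLHS]big_mkcondl /=.
  by apply: ler_sum => x _; case: ifP => // _; exact: sqr_ge0.
have -> : 4 / delta ^+ 3 = 4 / delta ^+ 2 / delta by field; rewrite gt_eqF.
rewrite (eq_bigl (fun x => near x && (x != n))); last by move=> x; rewrite andbC.
apply: near_sum_le; first by rewrite divr_ge0// exprn_ge0// ltW.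
move=> x xn /(near_sep xn nn) h.
have hx : delta / 2 <= `|om x - u|.
  have := ler_distD u (om x) (om n); move: h un; rewrite (distrC u).
  by lra.
have d2 : 0 < delta / 2 by rewrite divr_gt0.
rewrite mul1r exprVn -(real_normK (num_real (om x - u))).
have -> : 4 / delta ^+ 2 = ((delta / 2) ^+ 2)^-1 by field; rewrite gt_eqF.
have hx0 : 0 < `|om x - u| := lt_le_trans d2 hx.
by rewrite lef_pV2 ?posrE ?exprn_gt0// ler_sqr ?nnegrE// ltW.
Qed.

End ResolventSum.

(** * Deterministic estimates *)

Section NormRatio.
Context {R : realType} (M : nat).
Implicit Types (f : 'rV[R]_M) (x : 'I_M).

Lemma le_norm_infty f x : `|f ord0 x| <= norm_infty f.
Proof.
rewrite /norm_infty mx_normrE.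
exact: (@le_bigmax _ _ _ _ (fun ij : 'I_1 * 'I_M => `|f ij.1 ij.2|) (ord0, x)).
Qed.

Lemma norm_infty_le_norm2 f : norm_infty f <= norm2 f.
Proof.
rewrite /norm_infty mx_normrE; apply: bigmax_le; first exact: sqrtr_ge0.
move=> [i j] _ /=; rewrite (ord1 i) -sqrtr_sqr; apply: ler_wsqrtr.
by rewrite (bigD1 j)//= lerDl sumr_ge0// => k _; exact: sqr_ge0.
Qed.

(** The square of the 2-norm is at most (1 + s) f_x^2, hence at most (1 + s)^2 f_x^2, and |f_x|
    bounds the sup norm from below. *)
Lemma norm_ratio_le f x (s : R) : f ord0 x != 0 ->
  \sum_(y | y != x) f ord0 y ^+ 2 <= s * f ord0 x ^+ 2 ->
  1 <= norm2 f / norm_infty f <= 1 + s.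
Proof.
move=> fx0 hs; have fx : 0 < `|f ord0 x| by rewrite normr_gt0.
have n0 : 0 < norm_infty f := lt_le_trans fx (le_norm_infty f x).
have s0 : 0 <= s.
  rewrite -(pmulr_lge0 (x := f ord0 x ^+ 2)) ?exprn_even_gt0//.
  by apply: le_trans hs; apply: sumr_ge0 => y _; exact: sqr_ge0.
rewrite ler_pdivlMr// mul1r norm_infty_le_norm2 ler_pdivrMr//=.
apply: (@le_trans _ _ ((1 + s) * `|f ord0 x|)); last first.
  by rewrite ler_wpM2l ?le_norm_infty// addr_ge0.
have h : 0 <= (1 + s) * `|f ord0 x| by rewrite mulr_ge0// addr_ge0.
rewrite /norm2 -[leRHS](ger0_norm h) -sqrtr_sqr ler_wsqrtr//.
rewrite (bigD1 x)//= exprMn real_normK ?num_real//.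
have f2 : 0 <= f ord0 x ^+ 2 by exact: sqr_ge0.
have : 0 <= s ^+ 2 * f ord0 x ^+ 2 by rewrite mulr_ge0// sqr_ge0.
move: hs f2; set F := f ord0 x ^+ 2; set S := \sum_(_ | _) _ => hs f2 h2.
have h3 : 0 <= s * F by rewrite mulr_ge0.
have -> : (1 + s) ^+ 2 * F = F + 2 * (s * F) + s ^+ 2 * F by ring.
lra.
Qed.

End NormRatio.

Lemma sum_const_card {R : realType} (I : finType) (c : R) :
  \sum_(x : I) c = #|I|%:R * c.
Proof.
by rewrite sumr_const -[LHS]mulr_natl; congr (_%:R * _); exact: eq_card.
Qed.

(** * The sum over the sites outside the window *)

Section FarSum.
Context {R : realType} (I : finType).
Variables (y : I -> R) (E e D L W eta tau : R).
Local Notation om x := ((y x - e) / D).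
Local Notation Q := (#|I|%:R * D).
Hypotheses (D0 : 0 < D) (E0 : E != 0) (eta0 : 0 < eta).
Hypotheses (etaE : eta <= `|E| / 4) (eE : `|e - E| <= eta / 2).
Hypotheses (DW : D * W <= eta / 2) (LW : 2 * W + 2 <= L) (W0 : 0 <= W).
Hypothesis (LD : L * D <= `|E| / 4).
Hypothesis tail_few : \sum_(x | eta < `|y x|) 1 <= tau * #|I|%:R.
Hypothesis mid_sum :
  \sum_(x | (L < `|om x|) && (`|y x - e| <= `|E| / 4)) `|om x|^-1 <= tau * Q.

(** The three summands come from the bulk sites with |y x| <= eta, from the few sites with |y x| >
    eta, and from the sites beyond L whose energy is still within |E| / 4 of e. *)
Definition far_error := 4 * eta / E ^+ 2 + 9 / `|E| * tau + 2 * tau.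

(** Extended by 0 to the near sites, so that comparing every site with - D / E produces exactly - Q
    / E. *)
Let term (u : R) x : R := if L < `|om x| then 1 / (om x - u) else 0.

Lemma norm_omD x : `|om x| * D = `|y x - e|.
Proof. by rewrite normrM normfV (gtr0_norm D0) divfK// gt_eqF. Qed.

Lemma inv_om_sub_le u x : `|u| <= W -> L < `|om x| ->
  `|1 / (om x - u)| <= 2 * `|om x|^-1.
Proof.
move=> uW Lo; have hW := W0; have hL := LW.
have h := lerB_dist (om x) u.
rewrite mul1r normfV -[2]invrK -invfM lef_pV2 ?posrE; last 2 first.
- by move: uW Lo h; lra.
- by move: uW Lo h; lra.
by move: uW Lo h; lra.
Qed.

(** For a bulk site D (om x - u) is close to - E, so the term is - D / E up to a first-order error
    in eta. All other sites satisfy |y x| > eta and are bounded crudely, with the large terms close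
    to e kept as multiples of 1 / |om x|. *)
Lemma term_approx u x : `|u| <= W ->
  `|term u x + D / E| <= 4 * eta / E ^+ 2 * D
    + (if eta < `|y x| then 9 / `|E| * D else 0)
    + (if (L < `|om x|) && (`|y x - e| <= `|E| / 4) then 2 * `|om x|^-1 else 0).
Proof.
move=> uW; have E0' : 0 < `|E| by rewrite normr_gt0.
have h1 := etaE; have h2 := eE; have h3 := DW; have h4 := LD; have h5 := eta0.
have h6 := D0.
have DE : `|D / E| = D / `|E| by rewrite normrM normfV (gtr0_norm D0).
have e4 : 0 <= 4 * eta / E ^+ 2 * D.
  apply: mulr_ge0 (ltW D0); apply: divr_ge0 (sqr_ge0 _).
  by apply: mulr_ge0 (ltW eta0).
have De0 : 0 <= D / `|E| by rewrite divr_ge0 ?ltW.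
have eE' : `|E| - eta / 2 <= `|e|.
  by have := lerB_dist E e; move: h2; rewrite distrC; lra.
rewrite /term; case: (ltP L `|om x|) => Lo /=; last first.
  (* A near site is within |E| / 4 of e, hence away from 0; its term is 0 and only the comparison
     value D / |E| remains. *)
  have yx : eta < `|y x|.
    have : `|y x - e| <= L * D by rewrite -norm_omD ler_pM2r.
    have := lerB_dist e (y x); rewrite distrC; move: h4 eE'.
    lra.
  rewrite yx add0r addr0 DE.
  have -> : 9 / `|E| * D = 9 * (D / `|E|) by ring.
  lra.
have hu := inv_om_sub_le uW Lo.
case: (lerP `|y x - e| (`|E| / 4)) => ye /=.
  have yx : eta < `|y x|.
    have := lerB_dist e (y x); rewrite distrC; move: ye eE'.
    lra.
  rewrite yx; apply: le_trans (ler_normD _ _) _; rewrite DE.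
  have -> : 9 / `|E| * D = 9 * (D / `|E|) by ring.
  move: hu; set a := `|1 / _|; set b := 2 * _; lra.
rewrite addr0; case: (ltP eta `|y x|) => yx.
  apply: le_trans (ler_normD _ _) _; rewrite DE.
  (* Here |y x - e| > |E| / 4. The 8 from this bound and the 1 from the comparison value make up the
     constant 9. *)
  have : 2 * `|om x|^-1 <= 8 * (D / `|E|).
    have oE : `|E| / 4 / D <= `|om x|.
      by rewrite ler_pdivrMr// norm_omD ltW.
    have -> : 8 * (D / `|E|) = 2 * (`|E| / 4 / D)^-1.
      by field; rewrite !gt_eqF.
    rewrite ler_pM2l// lef_pV2 ?posrE ?divr_gt0//.
    by apply: lt_le_trans oE; rewrite !divr_gt0.
  have -> : 9 / `|E| * D = 9 * (D / `|E|) by ring.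
  move: hu; set a := `|1 / _|; set b := 2 * _; lra.
rewrite addr0.
(* This is D (om x - u); in the bulk case |E + z| <= 2 eta and |z| >= |E| / 2. *)
set z := y x - e - D * u.
have Du : `|D * u| <= eta / 2.
  by rewrite normrM (gtr0_norm D0); apply: le_trans h3; rewrite ler_pM2l.
have zE : `|E| / 2 <= `|z|.
  have a1 := lerB_dist e (y x - D * u); have a2 := ler_normB (y x) (D * u).
  move: a1; rewrite distrC (_ : y x - D * u - e = z); last by rewrite /z; ring.
  move: a2 Du yx eE'.
  lra.
have Ez : `|E + z| <= 2 * eta.
  have -> : E + z = (E - e) + y x - D * u by rewrite /z; ring.
  have a1 := ler_normB (E - e + y x) (D * u).
  have a2 := ler_normD (E - e) (y x).
  move: a1 a2 Du yx h2; rewrite (distrC e).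
  lra.
have z0 : z != 0 by rewrite -normr_gt0; apply: lt_le_trans zE; rewrite divr_gt0.
have omz : om x - u = z / D by rewrite /z; field; rewrite gt_eqF.
have -> : 1 / (om x - u) + D / E = D * (E + z) / (z * E).
  by rewrite omz; field; rewrite z0 E0 gt_eqF.
rewrite !normrM normfV normrM (gtr0_norm D0).
rewrite ler_pdivrMr ?mulr_gt0 ?normr_gt0//.
have -> : 4 * eta / E ^+ 2 * D * (`|z| * `|E|) =
   D * (2 * eta * (`|z| / (`|E| / 2))).
  rewrite -(real_normK (num_real E)); field; exact: lt0r_neq0.
rewrite ler_pM2l//; apply: le_trans Ez _.
apply: ler_peMr; first by rewrite mulr_ge0 ?(ltW eta0).
by rewrite ler_pdivlMr ?divr_gt0// mul1r.
Qed.

(** The absolute values stay inside the sum because the bound on the sum of squares uses this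
    estimate too. *)
Lemma sum_term_approx u : `|u| <= W ->
  \sum_x `|term u x + D / E| <= far_error * Q.
Proof.
move=> uW; apply: (@le_trans _ _ (\sum_x (4 * eta / E ^+ 2 * D
    + (if eta < `|y x| then 9 / `|E| * D else 0)
    + (if (L < `|om x|) && (`|y x - e| <= `|E| / 4) then 2 * `|om x|^-1 else 0)))).
  by apply: ler_sum => x _; exact: term_approx.
rewrite !big_split /= sum_const_card -!big_mkcond /= -[9 / `|E| * D]mulr1.
rewrite -!mulr_sumr /far_error.
have c0 : 0 <= 9 / `|E| * D by rewrite mulr_ge0 ?divr_ge0// ltW.
have := ler_wpM2l c0 tail_few; have := mid_sum.
set S1 := \sum_(_ | _) _; set S2 := \sum_(_ | _) _ => h1 h2.
have -> : (4 * eta / E ^+ 2 + 9 / `|E| * tau + 2 * tau) * Q =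
  #|I|%:R * (4 * eta / E ^+ 2 * D) + 9 / `|E| * D * (tau * #|I|%:R)
   + 2 * (tau * Q) by ring.
lra.
Qed.

Let far u := \sum_(x | ~~ (`|om x| <= L)) 1 / (om x - u).

Lemma far_term u : far u = \sum_x term u x.
Proof. by rewrite /far big_mkcond /=; apply: eq_bigr => x _; rewrite -ltNge. Qed.

Lemma far_sum_approx u : `|u| <= W -> `|far u + Q / E| <= far_error * Q.
Proof.
move=> uW; apply: le_trans (sum_term_approx uW).
have -> : far u + Q / E = \sum_x (term u x + D / E).
  by by rewrite big_split /= sum_const_card far_term mulrA.
exact: ler_norm_sum.
Qed.

(** Far sites satisfy |om x - u| >= 1, so each square is at most the absolute value, and an l^1
    bound of order Q suffices. *)
Lemma far_sum_sqr u : `|u| <= W ->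
  \sum_(x | ~~ (`|om x| <= L)) (1 / (om x - u)) ^+ 2 <=
  (`|E|^-1 + far_error) * Q.
Proof.
move=> uW; apply: (@le_trans _ _ (\sum_x (`|term u x + D / E| + D / `|E|))).
  rewrite big_mkcond /=; apply: ler_sum => x _; rewrite -ltNge /term.
  case: ifP => Lo; last by rewrite addr_ge0// divr_ge0// ltW.
  set t := 1 / _; apply: (@le_trans _ _ `|t|).
    rewrite -(real_normK (num_real t)) expr2 ler_piMl//.
    rewrite /t mul1r normfV invf_le1.
      have h := lerB_dist (om x) u; have hL := LW; have hW := W0.
      by move: uW Lo h; lra.
    have h := lerB_dist (om x) u; have hL := LW; have hW := W0.
    by move: uW Lo h; lra.
  have := ler_normB (t + D / E) (D / E); rewrite addrK => /le_trans; apply.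
  by rewrite [`|D / E|]normrM normfV (gtr0_norm D0).
rewrite big_split /= sum_const_card.
have -> : (`|E|^-1 + far_error) * Q = far_error * Q + #|I|%:R * (D / `|E|).
  by ring.
by rewrite lerD2r; exact: sum_term_approx.
Qed.

End FarSum.

(** * Asymptotics of the scaling parameters *)

Section Asymptotics.
Context {R : realType}.
Variables (lambda : R) (EM : nat -> R) (E : R).
Hypotheses (lambda0 : 0 < lambda) (hEM : EM M @[M --> \oo] --> E).
Local Notation ell M := (ln (M%:R : R)).
Local Notation kap M := (kappa lambda M).
Local Notation Del M := (Delta lambda M (EM M)).
Local Notation p0 := (normal_peak (1 : R)).

Lemma near_ln_ge (A : R) : \forall M \near \oo, A <= ell M.
Proof.
near=> M; rewrite -[A]expRK ler_ln ?posrE ?expR_gt0//; last first.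
  by rewrite ltr0n; near: M; exact: nbhs_infty_gt.
by apply: ltW; near: M; exact: nbhs_infty_gtr.
Unshelve. all: by end_near. Qed.

(** A single term of the exponential series, the one of degree n + 1, already outgrows the n-th
    power. *)
Lemma near_ln_exp (n : nat) (c eps : R) : 0 < c -> 0 < eps ->
  \forall M \near \oo, ell M ^+ n <= eps * expR (c * ell M).
Proof.
move=> c0 e0; near=> M.
have f0 : 0 < n.+1`!%:R :> R by rewrite ltr0n fact_gt0.
have l1 : n.+1`!%:R / (eps * c ^+ n.+1) <= ell M by near: M; exact: near_ln_ge.
have l0 : 0 <= ell M by near: M; exact: near_ln_ge.
have h : (c * ell M) ^+ n.+1 / n.+1`!%:R <= expR (c * ell M).
  by apply: le_trans (expR_ge1Dxn n _); rewrite ?lerDr// mulr_ge0// ltW.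
apply: le_trans (ler_wpM2l (ltW e0) h).
move: l1; rewrite ler_pdivrMr ?mulr_gt0 ?exprn_gt0// => l1.
rewrite mulrA ler_pdivlMr// exprMn [ell M ^+ n.+1]exprS.
have -> : eps * (c ^+ n.+1 * (ell M * ell M ^+ n)) =
  ell M ^+ n * (ell M * (eps * c ^+ n.+1)) by ring.
by rewrite ler_wpM2l ?exprn_ge0.
Unshelve. all: by end_near. Qed.

Lemma normal_pdf01E (x : R) : normal_pdf 0 1 x = p0 * expR (- (x ^+ 2 / 2)).
Proof.
by rewrite normal_pdfE ?oner_eq0// /normal_fun subr0 expr1n mulNr.
Qed.

Lemma peak_gt0 : 0 < p0.
Proof. exact: normal_peak_gt0. Qed.

Lemma kappa_gt0 M : 0 < ell M -> 0 < kap M.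
Proof. by move=> l0; rewrite divr_gt0// sqrtr_gt0 mulr_gt0. Qed.

Lemma kappa_sqr M : 0 < ell M -> kap M ^+ 2 = lambda ^+ 2 / (2 * ell M).
Proof. by move=> l0; rewrite exprMn exprVn sqr_sqrtr// mulr_ge0// ltW. Qed.

(** The scaling of [kappa] turns the Gaussian density at energy x into the power M^(- (x /
    lambda)^2), up to a constant. *)
Lemma normal_pdf_kappa M (x : R) : 0 < ell M ->
  normal_pdf 0 1 (x / kap M) = p0 * expR (- ((x / lambda) ^+ 2 * ell M)).
Proof.
move=> l0; rewrite normal_pdf01E; congr (_ * expR (- _)).
rewrite exprMn exprVn kappa_sqr//; field.
by rewrite !gt_eqF.
Qed.

Lemma Q_E M : 0 < ell M ->
  M%:R * Del M = kap M / p0 * expR ((EM M / lambda) ^+ 2 * ell M).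
Proof.
move=> l0; have M0 : M%:R != 0 :> R.
  by apply/eqP => M0; move: l0; rewrite M0 ln0// ltxx.
rewrite /Delta normal_pdf_kappa// expRN.
by field; rewrite M0 !gt_eqF ?expR_gt0 ?peak_gt0.
Qed.

Lemma Delta_E M : 0 < ell M ->
  Del M = kap M / p0 * expR (- ((1 - (EM M / lambda) ^+ 2) * ell M)).
Proof.
move=> l0; have M0 : 0 < M%:R :> R.
  rewrite ltr0n lt0n; apply/eqP => M0.
  by move: l0; rewrite M0 ln0// ltxx.
apply: (mulfI (lt0r_neq0 M0)); rewrite Q_E//.
rewrite mulrCA; congr (_ * _).
have hM : expR (ell M) = M%:R by exact: lnK.
set l := ell M in hM *; rewrite -hM -expRD; congr expR; ring.
Qed.

Lemma Delta_gt0 M : 0 < ell M -> 0 < Del M.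
Proof.
move=> l0; rewrite Delta_E// mulr_gt0 ?expR_gt0// divr_gt0 ?peak_gt0//.
exact: kappa_gt0.
Qed.

(** The square root of 2 ln M is bounded by 2 ln M itself; this loses only powers of ln M, which are
    harmless below. *)
Lemma kappa_ge M : 1 <= ell M -> lambda / (2 * ell M) <= kap M.
Proof.
move=> l1; have l0 : 0 < ell M := lt_le_trans ltr01 l1.
have l20 : 0 < 2 * ell M by rewrite mulr_gt0.
rewrite /kappa ler_pM2l// lef_pV2 ?posrE ?sqrtr_gt0//.
rewrite -[leRHS]ger0_norm ?(ltW l20)// -sqrtr_sqr ler_wsqrtr//.
by rewrite expr2 ler_peMr ?(ltW l20)//; lra.
Qed.

Lemma kappa_le M : 1 <= ell M -> kap M <= lambda.
Proof.
move=> l1; have l0 : 0 < ell M := lt_le_trans ltr01 l1.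
rewrite /kappa ler_pdivrMr ?sqrtr_gt0 ?mulr_gt0//.
rewrite ler_peMr ?(ltW lambda0)// -[leLHS]sqrtr1 ler_wsqrtr//; lra.
Qed.

Lemma near_kappa_le (eps : R) : 0 < eps -> \forall M \near \oo, kap M <= eps.
Proof.
move=> e0; near=> M.
have l1 : 1 <= ell M by near: M; exact: near_ln_ge.
have le : (lambda / eps) ^+ 2 <= ell M by near: M; exact: near_ln_ge.
have l0 : 0 < ell M := lt_le_trans ltr01 l1.
rewrite /kappa ler_pdivrMr ?sqrtr_gt0 ?mulr_gt0//.
rewrite mulrC -ler_pdivrMr//.
have le0 : 0 <= lambda / eps by rewrite divr_ge0 ?ltW.
rewrite -[leLHS]ger0_norm// -sqrtr_sqr ler_wsqrtr//; lra.
Unshelve. all: by end_near. Qed.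

Lemma near_EM (eps : R) : 0 < eps -> \forall M \near \oo, `|EM M - E| <= eps.
Proof.
move=> e0; have /cvgrPdist_le /(_ _ e0) := hEM.
by apply: filterS => M; rewrite distrC.
Qed.

Lemma cvg_exponent : (EM M / lambda) ^+ 2 @[M --> \oo] --> (E / lambda) ^+ 2.
Proof.
rewrite expr2; under eq_fun do rewrite expr2.
by apply: cvgM; apply: cvgM => //; exact: cvg_cst.
Qed.

(** Up to [kappa] and a constant, M [Delta] is M^((EM M / lambda)^2). The midpoint exponent b' lies
    eventually below that power, and the surplus M^(b' - b) absorbs the logarithms, including the
    one from 1 / kappa. *)
Lemma near_Q_ge (b eps : R) (n : nat) : b < (E / lambda) ^+ 2 -> 0 < eps ->
  \forall M \near \oo,
    ell M ^+ n * expR (b * ell M) <= eps * (M%:R * Del M).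
Proof.
move=> bE e0; pose b' := (b + (E / lambda) ^+ 2) / 2.
have bb' : b < b' by rewrite /b'; lra.
have b'E : b' < (E / lambda) ^+ 2 by rewrite /b'; lra.
have pp := peak_gt0.
have c0 : 0 < eps * lambda / (2 * p0) by rewrite divr_gt0 ?mulr_gt0.
have d0 : 0 < b' - b by lra.
near=> M.
have l1 : 1 <= ell M by near: M; exact: near_ln_ge.
have l0 : 0 < ell M := lt_le_trans ltr01 l1.
have hb : b' <= (EM M / lambda) ^+ 2.
  near: M; have := cvg_exponent => /cvgr_gt /(_ _ b'E).
  by apply: filterS => M /ltW.
rewrite Q_E// mulrA.
apply: (@le_trans _ _ (eps * (lambda / (2 * ell M) / p0) * expR (b' * ell M))).
  have -> : expR (b' * ell M) = expR ((b' - b) * ell M) * expR (b * ell M).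
    by rewrite -expRD; congr expR; ring.
  rewrite mulrA ler_pM2r ?expR_gt0//.
  have : ell M ^+ n.+1 <= eps * lambda / (2 * p0) * expR ((b' - b) * ell M).
    by near: M; exact: near_ln_exp.
  set X := expR _ => h.
  rewrite -(ler_pM2l l0) -exprS; apply: le_trans h _.
  by rewrite le_eqVlt; apply/orP; left; apply/eqP; field; rewrite !gt_eqF.
apply: ler_pM; [|exact: expR_ge0| |].
- by rewrite ltW// mulr_gt0// !divr_gt0// mulr_gt0.
- rewrite ler_pM2l//; apply: ler_wpM2r; first by rewrite invr_ge0 ltW.
  exact: kappa_ge.
by rewrite ler_expR ler_pM2r.
Unshelve. all: by end_near. Qed.

(** Since |E| < lambda, [Delta] decays like a negative power of M, which beats any power of ln M. A
    midpoint exponent again absorbs the convergence of [EM]. *)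
Lemma near_Delta_le (eps : R) (n : nat) : (E / lambda) ^+ 2 < 1 -> 0 < eps ->
  \forall M \near \oo, ell M ^+ n * Del M <= eps.
Proof.
move=> bE e0; pose b' := (1 + (E / lambda) ^+ 2) / 2.
have b'1 : b' < 1 by rewrite /b'; lra.
have b'E : (E / lambda) ^+ 2 < b' by rewrite /b'; lra.
have pp := peak_gt0.
have d0 : 0 < 1 - b' by lra.
have c0 : 0 < eps * p0 / lambda by rewrite divr_gt0 ?mulr_gt0.
near=> M.
have l1 : 1 <= ell M by near: M; exact: near_ln_ge.
have l0 : 0 < ell M := lt_le_trans ltr01 l1.
have hb : (EM M / lambda) ^+ 2 <= b'.
  near: M; have := cvg_exponent => /cvgr_lt /(_ _ b'E).
  by apply: filterS => M /ltW.
have : ell M ^+ n <= eps * p0 / lambda * expR ((1 - b') * ell M).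
  by near: M; exact: near_ln_exp.
set X := expR _ => h; have X0 : 0 < X by exact: expR_gt0.
rewrite Delta_E//; apply: (@le_trans _ _ (ell M ^+ n * (lambda / p0 * X^-1))).
  apply: ler_wpM2l; first by rewrite exprn_ge0// ltW.
  apply: ler_pM; [|exact: expR_ge0| |].
  - by rewrite divr_ge0 ?(ltW pp)// ltW// kappa_gt0.
  - apply: ler_wpM2r; first by rewrite invr_ge0 ltW.
    exact: kappa_le.
  by rewrite -expRN ler_expR lerN2 ler_pM2r//; lra.
rewrite mulrA ler_pdivrMr// mulrA ler_pdivrMr//.
move: h; rewrite mulrAC ler_pdivlMr//.
by rewrite [eps * p0 * X]mulrAC.
Unshelve. all: by end_near. Qed.

(** Energies this close to [EM M] have |y| >= |E| / 2, so the density there is a negative power of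
    M. *)
Lemma near_pdf_far (n : nat) (eps : R) : E != 0 -> 0 < eps ->
  \forall M \near \oo, forall y, `|y - EM M| <= `|E| / 4 ->
    ell M ^+ n * normal_pdf 0 1 (y / kap M) <= eps.
Proof.
move=> E0 e0; have E0' : 0 < `|E| by rewrite normr_gt0.
have pp := peak_gt0.
have c0 : 0 < (`|E| / 2 / lambda) ^+ 2 by rewrite exprn_gt0 ?divr_gt0.
have c1 : 0 < eps / p0 by rewrite divr_gt0.
near=> M => y hy.
have l1 : 1 <= ell M by near: M; exact: near_ln_ge.
have l0 : 0 < ell M := lt_le_trans ltr01 l1.
have eE : `|EM M - E| <= `|E| / 4 by near: M; apply: near_EM; rewrite divr_gt0.
have : ell M ^+ n <= eps / p0 * expR ((`|E| / 2 / lambda) ^+ 2 * ell M).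
  by near: M; exact: near_ln_exp.
set X := expR _ => h; have X0 : 0 < X by exact: expR_gt0.
have yE : `|E| / 2 <= `|y|.
  have := lerB_dist E y; have := ler_distD (EM M) E y.
  by rewrite (distrC E (EM M)) (distrC (EM M) y); lra.
rewrite normal_pdf_kappa//.
apply: (@le_trans _ _ (ell M ^+ n * (p0 * X^-1))).
  apply: ler_wpM2l; first by rewrite exprn_ge0// ltW.
  rewrite ler_pM2l// -expRN ler_expR lerN2 ler_pM2r//.
  rewrite -[leRHS](real_normK (num_real _)) ler_sqr ?nnegrE ?divr_ge0 ?(ltW lambda0)//.
  by rewrite normrM normfV (gtr0_norm lambda0) ler_pM2r ?invr_gt0.
rewrite mulrA ler_pdivrMr//; move: h.
by rewrite mulrAC ler_pdivlMr.
Unshelve. all: by end_near. Qed.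

(** Controls the mixed term when the square of e + D s is expanded in the Gaussian exponent. *)
Lemma cross_term_ge (e D s l A B : R) : 0 <= l -> 0 <= D -> 0 < A -> 0 < B ->
  `|e| <= A -> `|s| <= B -> l * D <= lambda ^+ 2 / 4 / (A * B) ->
  - (1 / 2) <= 2 * e * D * s / lambda ^+ 2 * l.
Proof.
move=> l0 D0 A0 B0 eA sB hD.
rewrite lerNl; apply: le_trans (ler_norm _) _; rewrite normrN.
rewrite !normrM normfV (ger0_norm D0) (ger0_norm l0).
rewrite (ger0_norm (sqr_ge0 lambda)) (ger0_norm (ler0n _ 2)).
have -> : 2 * `|e| * D * `|s| / lambda ^+ 2 * l =
  (2 * (l * D) / lambda ^+ 2) * (`|e| * `|s|) by ring.
have -> : 1 / 2 = (2 * (lambda ^+ 2 / 4 / (A * B)) / lambda ^+ 2) * (A * B).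
  by field; rewrite !gt_eqF.
have i0 : 0 <= (lambda ^+ 2)^-1 by rewrite invr_ge0 sqr_ge0.
apply: ler_pM; [| |by rewrite ler_wpM2r// ler_pM2l|by apply: ler_pM].
  by rewrite mulr_ge0// mulr_ge0// mulr_ge0.
by rewrite mulr_ge0.
Qed.

(** Moving by [Delta * s] changes the exponent by the cross term plus a nonnegative square, so the
    density grows by at most exp(1/2) <= 2. *)
Lemma near_pdf_local (L : R) : (E / lambda) ^+ 2 < 1 ->
  \forall M \near \oo, forall s, `|s| <= L ->
    normal_pdf 0 1 ((EM M + Del M * s) / kap M) <=
    2 * normal_pdf 0 1 (EM M / kap M).
Proof.
move=> E1; have hL0 : 0 <= `|L| by [].
pose c := lambda ^+ 2 / 4 / ((`|E| + 1) * (`|L| + 1)).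
have c0 : 0 < c.
  by rewrite divr_gt0 ?divr_gt0 ?exprn_gt0 ?mulr_gt0// ltr_wpDl.
near=> M => s hs.
have l1 : 1 <= ell M by near: M; exact: near_ln_ge.
have l0 : 0 < ell M := lt_le_trans ltr01 l1.
have eE : `|EM M - E| <= 1 by near: M; exact: near_EM.
have D0 := Delta_gt0 l0; have pp := peak_gt0.
have hD : ell M ^+ 1 * Del M <= c by near: M; exact: near_Delta_le.
rewrite !normal_pdf_kappa// mulrCA ler_pM2l//.
set e := EM M; set D := Del M in hD D0 *; set l := ell M in l1 l0 hD *.
have e1 : `|e| <= `|E| + 1.
  by have := ler_normD (e - E) E; rewrite subrK; rewrite /e; lra.
have sL : `|s| <= `|L| + 1 by have := ler_norm L; lra.
have key : - (1 / 2) <= (2 * e * D * s / lambda ^+ 2) * l.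
  exact: (@cross_term_ge _ _ _ _ (`|E| + 1) (`|L| + 1) (ltW l0) (ltW D0)).
have half : expR (1 / 2) <= 2 :> R.
  have : 1 / 2 <= expR (- (1 / 2)) :> R.
    by apply: le_trans (expR_ge1Dx _); lra.
  by rewrite expRN -[X in X <= _]invrK lef_pV2 ?posrE ?expR_gt0 ?invr_gt0// mul1r invrK.
have -> : (e / lambda) ^+ 2 * l = ((e + D * s) / lambda) ^+ 2 * l
    - ((2 * e * D * s / lambda ^+ 2) * l + (D * s / lambda) ^+ 2 * l).
  by field; rewrite gt_eqF.
set t := (_ / lambda) ^+ 2 * l; set r := _ + (D * s / lambda) ^+ 2 * l.
have hr : - (1 / 2) <= r.
  by have : 0 <= (D * s / lambda) ^+ 2 * l;
    [rewrite mulr_ge0 ?sqr_ge0 ?ltW | rewrite /r; lra].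
apply: (@le_trans _ _ (expR (1 / 2) * expR (- (t - r)))).
  by rewrite -expRD ler_expR; lra.
by rewrite ler_pM2r ?expR_gt0.
Unshelve. all: by end_near. Qed.

End Asymptotics.

(** * Good events *)

Lemma whp_markov {R : realType} (d : nat -> measure_display)
    (T : forall n, measurableType (d n)) (P : forall n, probability (T n) R)
    (I : nat -> finType) (A : forall n, I n -> set (T n)) (c : forall n, I n -> R) :
  (forall eps, 0 < eps -> \forall n \near \oo,
    [/\ forall i, measurable (A n i), forall i, 0 <= c n i &
      exists2 p : I n -> R, forall i, (P n (A n i) <= (p i)%:E)%E &
        \sum_i c n i * p i <= eps]) ->
  whp P (fun n => [set w | \sum_i c n i * \1_(A n i) w < 1]).
Proof.
move=> h eps e0; have := h eps e0; apply: filterS => n [mA c0 [p pA hp]].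
have [B [mB sB pB]] := markov_indic mA c0 pA; exists B; split => //.
by apply: le_trans pB _; rewrite lee_fin.
Qed.

(* Sums of 1/|omega_x| are controlled by counting sites in exponential shells, so
   that only small-ball bounds, and no integral of 1/|omega|, are needed. *)
Lemma inv_le_shells {R : realType} (K : nat) (L z : R) : 0 < L ->
  L < z <= expR K%:R * L ->
  z^-1 <= \sum_(k < K) (if z <= expR k.+1%:R * L then expR (- k%:R) / L else 0).
Proof.
move=> L0; elim: K => [|K IH] /andP[Lz zK].
  by move: zK; rewrite expR0 mul1r leNgt Lz.
have z0 : 0 < z := lt_trans L0 Lz.
rewrite big_ord_recr /= zK; have [zK'|Kz] := lerP z (expR K%:R * L).
  rewrite -[leLHS]addr0; apply: lerD; first by apply: IH; rewrite Lz.
  by rewrite divr_ge0 ?expR_ge0// ltW.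
rewrite -[leLHS]add0r; apply: lerD.
  by apply: sumr_ge0 => k _; case: ifP => // _; rewrite divr_ge0 ?expR_ge0// ltW.
rewrite expRN -invfM lef_pV2 ?posrE ?mulr_gt0 ?expR_gt0//.
exact: ltW.
Qed.

Section GoodEvents.
Context {R : realType} (d : nat -> measure_display).
Context (T : forall M, measurableType (d M)) (P : forall M, probability (T M) R).
Variable V : forall M, 'I_M -> {RV (P M) >-> R}.
Arguments V : clear implicits.
Hypothesis hindep : forall M, (2 <= M)%N -> mutually_independent (V M).
Hypothesis hgauss : forall M, (2 <= M)%N -> forall x, standard_gaussian (V M x).
Variables (lambda : R) (EM : nat -> R) (E : R).
Hypotheses (lambda0 : 0 < lambda) (hEM : EM M @[M --> \oo] --> E).
Hypotheses (E0 : E != 0) (E1 : (E / lambda) ^+ 2 < 1).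
Local Notation ell M := (ln (M%:R : R)).
Local Notation kap M := (kappa lambda M).
Local Notation Del M := (Delta lambda M (EM M)).
Local Notation om M w x := (omega lambda (EM M) (fun y => V M y w) x).

Lemma omega_itv M (w : T M) (x : 'I_M) (s t : R) : 0 < kap M -> 0 < Del M ->
  (s <= om M w x <= t) =
  (V M x w \in `[(EM M + Del M * s) / kap M, (EM M + Del M * t) / kap M]).
Proof.
move=> k0 D0; rewrite in_itv /= /omega /rescale.
rewrite ler_pdivlMr// ler_pdivrMr// ler_pdivrMr// ler_pdivlMr//.
by rewrite lerBrDl lerBlDl ![kap M * _]mulrC ![Del M * _]mulrC.
Qed.

Lemma omega_itv_preimage M (x : 'I_M) (s t : R) : 0 < kap M -> 0 < Del M ->
  [set w | (s <= om M w x <= t)%R] =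
  V M x @^-1` `[(EM M + Del M * s) / kap M, (EM M + Del M * t) / kap M].
Proof. by move=> k0 D0; apply/seteqP; split => w /=; rewrite omega_itv. Qed.

Lemma measurable_omega_itv M (x : 'I_M) (s t : R) : 0 < kap M -> 0 < Del M ->
  measurable [set w | (s <= om M w x <= t)%R].
Proof.
by move=> k0 D0; rewrite omega_itv_preimage// -[X in measurable X]setTI; exact: measurable_funPT.
Qed.

Lemma near_M_ge2 : \forall M \near \oo, (2 <= M)%N.
Proof. exact: nbhs_infty_ge. Qed.

Lemma omega_ball M (x : 'I_M) (s t c : R) : (2 <= M)%N ->
  0 < kap M -> 0 < Del M -> s <= t ->
  (forall z, s <= z <= t -> normal_pdf 0 1 ((EM M + Del M * z) / kap M) <= c) ->
  (P M [set w | (s <= om M w x <= t)%R]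
    <= (c * (Del M * (t - s) / kap M))%:E)%E.
Proof.
move=> M2 k0 D0 st hc; rewrite omega_itv_preimage//.
have -> : Del M * (t - s) / kap M =
  (EM M + Del M * t) / kap M - (EM M + Del M * s) / kap M by ring.
apply: gaussian_small_ball; first exact: hgauss.
  by rewrite ler_pM2r ?invr_gt0// lerD2l ler_pM2l.
move=> v /andP[v1 v2]; have := hc ((kap M * v - EM M) / Del M).
have -> : (EM M + Del M * ((kap M * v - EM M) / Del M)) / kap M = v.
  by field; rewrite !gt_eqF.
apply; move: v1 v2; rewrite ler_pdivrMr// ler_pdivlMr// => v1 v2.
rewrite ler_pdivlMr// ler_pdivrMr// lerBrDl lerBlDl.
by rewrite ![_ * Del M]mulrC [kap M * v]mulrC v1.
Qed.

(** [Delta] is normalised so that the density at [EM M] times [Delta / kappa] is 1 / M; the factor 2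
    covers the variation of the density over the window. *)
Lemma near_omega_itv (L : R) : \forall M \near \oo,
  forall (x : 'I_M) (s t : R), s <= t -> `|s| <= L -> `|t| <= L ->
  measurable [set w | (s <= om M w x <= t)%R] /\
  (P M [set w | (s <= om M w x <= t)%R] <= (2 * (t - s) / M%:R)%:E)%E.
Proof.
near=> M => x s t st sL tL.
have M2 : (2 <= M)%N by near: M; exact: near_M_ge2.
have l0 : 0 < ell M by rewrite ln_gt0// ltr1n.
have k0 : 0 < kap M := kappa_gt0 lambda0 l0.
have D0 : 0 < Del M := Delta_gt0 EM lambda0 l0.
split; first exact: measurable_omega_itv.
have hpdf : forall s, `|s| <= L ->
    normal_pdf 0 1 ((EM M + Del M * s) / kap M) <=
    2 * normal_pdf 0 1 (EM M / kap M).
  by near: M; exact: (near_pdf_local lambda0 hEM L E1).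
apply: le_trans (omega_ball x M2 k0 D0 st (c := 2 * normal_pdf 0 1 (EM M / kap M)) _) _.
  move=> z /andP[sz zt]; apply: hpdf; move: sL tL; rewrite !ler_norml; lra.
rewrite lee_fin /Delta.
have M0 : M%:R != 0 :> R by rewrite pnatr_eq0 -lt0n (leq_trans _ M2).
have : normal_pdf 0 1 (EM M / kap M) != 0.
  by rewrite normal_pdf01E mulf_neq0 ?gt_eqF ?expR_gt0 ?peak_gt0.
set p := normal_pdf _ _ _ => pn0.
rewrite le_eqVlt; apply/orP; left; apply/eqP.
by field; rewrite M0 pn0 gt_eqF.
Unshelve. all: by end_near. Qed.

Definition few_near (L : R) M := [set w : T M |
  \sum_(x | `|om M w x| <= L) 1 <= ell M].

(** The expected number of near sites is at most 4 L, so it exceeds ln M with probability O(1 / ln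
    M). *)
Lemma whp_few_near (L : R) : 0 <= L -> whp P (few_near L).
Proof.
move=> L0.
apply: (@whpS _ _ _ _ (fun M => [set w | \sum_(x : 'I_M)
    (ell M)^-1 * \1_[set w | (- L <= om M w x <= L)%R] w < 1])).
  near=> M => w /=.
  have l0 : 0 < ell M by near: M; apply: filterS (near_ln_ge (R:=R) 1) => M; exact: lt_le_trans.
  rewrite -mulr_sumr mulrC ltr_pdivrMr// mul1r => /ltW; apply: le_trans.
  rewrite big_mkcond /=; apply: ler_sum => x _.
  rewrite indicE ler_norml; case: ifP => // h.
  by rewrite mem_set.
apply: whp_markov => eps e0; near=> M.
have l0 : 0 < ell M by near: M; apply: filterS (near_ln_ge (R:=R) 1) => M; exact: lt_le_trans.
have M0 : 0 < M%:R :> R by rewrite ltr0n; near: M; exact: nbhs_infty_gt.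
have h : forall (x : 'I_M) (s t : R), s <= t -> `|s| <= L -> `|t| <= L ->
  measurable [set w | (s <= om M w x <= t)%R] /\
  (P M [set w | (s <= om M w x <= t)%R] <= (2 * (t - s) / M%:R)%:E)%E.
  by near: M; exact: near_omega_itv.
have hL : - L <= L by lra.
have nL1 : `|- L| <= L by rewrite normrN ger0_norm.
have nL2 : `|L| <= L by rewrite ger0_norm.
have hx x := h x (- L) L hL nL1 nL2.
split.
- by move=> x; have [] := hx x.
- by move=> x; rewrite invr_ge0 ltW.
exists (fun=> 2 * (L - - L) / M%:R).
  by move=> x; have [] := hx x.
rewrite sum_const_card card_ord.
have -> : M%:R * ((ell M)^-1 * (2 * (L - - L) / M%:R)) = 4 * L / ell M.
  by field; rewrite !gt_eqF.
rewrite ler_pdivrMr// -ler_pdivrMl//; near: M; exact: near_ln_ge.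
Unshelve. all: by end_near. Qed.

Definition separated (L : R) M := [set w : T M | forall x y : 'I_M,
  `|om M w x| <= L -> `|om M w y| <= L -> x != y ->
  (ell M)^-1 < `|om M w x - om M w y|].

(** Independence of the potential at two distinct sites enters here. *)
Lemma pair_itv M (x y : 'I_M) (s t p : R) : (2 <= M)%N ->
  0 < kap M -> 0 < Del M -> x != y -> 0 <= p ->
  (forall z : 'I_M, (P M [set w | (s <= om M w z <= t)%R]%classic <= p%:E)%E) ->
  (P M ([set w | (s <= om M w x <= t)%R] `&` [set w | (s <= om M w y <= t)%R])%classic
   <= (p ^+ 2)%:E)%E.
Proof.
move=> M2 k0 D0 xy p0 hp.
pose I : set R := [set` `[(EM M + Del M * s) / kap M, (EM M + Del M * t) / kap M]].
have hI z : [set w | (s <= om M w z <= t)%R] = V M z @^-1` I.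
  exact: omega_itv_preimage.
have := @hindep M M2 [set x; y]%SET (fun=> I) (fun=> measurable_itv _).
have -> : \bigcap_(i in [set` [set x; y]%SET]) V M i @^-1` I =
    ([set w | (s <= om M w x <= t)%R] `&` [set w | (s <= om M w y <= t)%R])%classic.
  rewrite !hI; apply/seteqP; split => w /=.
    by move=> h; split; apply: h; rewrite /= !inE eqxx ?orbT.
  by move=> [hx hy] z /=; rewrite !inE => /orP[/eqP ->|/eqP ->].
move=> ->; rewrite big_setU1 ?inE//= big_set1 -!hI expr2 EFinM.
by apply: lee_pmul => //; exact: measure_ge0.
Qed.

(** Two given sites share a given cell with probability at most p^2, where p = 4 / (M ln M). Over
    M^2 pairs and O(ln M) cells the expected number of coincidences is O(1 / ln M). *)
Lemma whp_separated (L : R) : 0 <= L -> whp P (separated L).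
Proof.
move=> L0.
(* Overlapping cells of width 2/ell: any two near values at distance at most 1/ell
   share a cell. *)
pose K M := (Num.truncn (2 * L * ell M)).+1.
pose s M (j : nat) : R := - L + j%:R / ell M.
have sS M j : s M j.+2 = s M j + 2 / ell M.
  by rewrite /s -addn2 natrD mulrDl addrA.
pose A M (i : 'I_M * 'I_M * 'I_(K M)) : set (T M) :=
  if i.1.1 == i.1.2 then set0 else
  [set w | (s M i.2 <= om M w i.1.1 <= s M i.2.+2)%R] `&`
  [set w | (s M i.2 <= om M w i.1.2 <= s M i.2.+2)%R].
apply: (@whpS _ _ _ _ (fun M => [set w | \sum_(i : 'I_M * 'I_M * 'I_(K M))
    1 * \1_(A M i) w < 1])).
  near=> M => w /= hlt x y; have l0 : 0 < ell M.
    by near: M; apply: filterS (near_ln_ge (R:=R) 1) => M; exact: lt_le_trans.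
  wlog xley : x y / om M w x <= om M w y.
    move=> hw hx hy xy; case: (leP (om M w x) (om M w y)) => [h|/ltW h].
      exact: hw.
    by rewrite distrC; apply: hw => //; rewrite eq_sym.
  rewrite !ler_norml => /andP[x1 x2] /andP[y1 y2] xy.
  rewrite ltNge; apply/negP; rewrite distrC ger0_norm ?subr_ge0// => hd.
  pose j := Num.truncn ((om M w x + L) * ell M).
  have z0 : 0 <= (om M w x + L) * ell M by rewrite mulr_ge0 ?(ltW l0)//; lra.
  have jK : (j < K M)%N.
    rewrite ltnS; apply: le_truncn; rewrite ler_pM2r//; lra.
  have /andP[j1 j2] := truncn_itv z0; rewrite -/j in j1 j2.
  have s1 : s M j <= om M w x.
    by rewrite /s -lerBrDl ler_pdivrMr// opprK.
  have s2 : om M w y <= s M j.+2.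
    have : om M w x + L < j.+1%:R / ell M by rewrite ltr_pdivlMr.
    by rewrite /s -[in j.+2%:R]natr1 mulrDl mul1r; lra.
  (* A sum of indicators below 1 means that none of the events occurs, while the pair found here
     realises one. *)
  move: hlt; rewrite ltNge => /negP; apply.
  rewrite (bigD1 (x, y, Ordinal jK))//= mul1r indicE mem_set.
    by rewrite lerDl sumr_ge0// => i _; rewrite mul1r.
  rewrite /A /= (negbTE xy); split => /=; rewrite ?s1 ?s2 ?andbT/=; lra.
apply: whp_markov => eps e0; near=> M.
have M2 : (2 <= M)%N by near: M; exact: near_M_ge2.
have l1 : 1 <= ell M by near: M; exact: near_ln_ge.
have l0 : 0 < ell M := lt_le_trans ltr01 l1.
have k0 : 0 < kap M := kappa_gt0 lambda0 l0.
have D0 : 0 < Del M := Delta_gt0 EM lambda0 l0.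
have M0 : 0 < M%:R :> R by rewrite ltr0n (leq_trans _ M2).
(* The last cells overshoot L by at most 2 / ln M <= 2. *)
have h : forall (x : 'I_M) (s t : R), s <= t -> `|s| <= L + 2 -> `|t| <= L + 2 ->
  measurable [set w | (s <= om M w x <= t)%R] /\
  (P M [set w | (s <= om M w x <= t)%R] <= (2 * (t - s) / M%:R)%:E)%E.
  by near: M; exact: near_omega_itv.
pose p := 4 / ell M / M%:R.
have p0 : 0 <= p by rewrite /p !divr_ge0 ?ltW.
have KL : (K M)%:R <= (2 * L + 1) * ell M.
  have -> : (K M)%:R = (Num.truncn (2 * L * ell M))%:R + 1 :> R by rewrite natr1.
  rewrite [leRHS]mulrDl mul1r; apply: lerD => //.
  by rewrite truncn_le !mulr_ge0// ltW.
have hA (x : 'I_M) (j : 'I_(K M)) : measurable [set w | (s M j <= om M w x <= s M j.+2)%R] /\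
    (P M [set w | (s M j <= om M w x <= s M j.+2)%R]%classic <= p%:E)%E.
  have -> : p = 2 * (s M j.+2 - s M j) / M%:R.
    by rewrite /p sS; field; rewrite !gt_eqF.
  have jl : 0 <= j%:R / ell M by rewrite divr_ge0// ltW.
  have jL : j%:R / ell M <= 2 * L.
    rewrite ler_pdivrMr//; apply: (@le_trans _ _ (Num.truncn (2 * L * ell M))%:R).
      by rewrite ler_nat -ltnS ltn_ord.
    by rewrite truncn_le !mulr_ge0// ltW.
  have l2 : 2 / ell M <= 2 by rewrite ler_pdivrMr// ler_peMr.
  have l3 : 0 <= 2 / ell M by rewrite divr_ge0// ltW.
  by apply: h; rewrite ?sS ?ler_norml /s; lra.
split => //.
- move=> [[x y] j]; rewrite /A /=; case: ifP => _; first exact: measurable0.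
  by apply: measurableI; [have [] := hA x j | have [] := hA y j].
exists (fun=> p ^+ 2).
  move=> [[x y] j]; rewrite /A /=; case: ifP => xy.
    by rewrite measure0 lee_fin sqr_ge0.
  by apply: pair_itv => //; [rewrite xy | move=> z; have [] := hA z j].
rewrite sum_const_card !card_prod !card_ord mul1r !natrM.
have -> : M%:R * M%:R * (K M)%:R * p ^+ 2 = 16 * (K M)%:R / ell M ^+ 2.
  by rewrite /p; field; rewrite !gt_eqF.
apply: (@le_trans _ _ (16 * ((2 * L + 1) * ell M) / ell M ^+ 2)).
  by rewrite ler_pM2r ?invr_gt0 ?exprn_gt0// ler_pM2l.
have -> : 16 * ((2 * L + 1) * ell M) / ell M ^+ 2 = 16 * (2 * L + 1) / ell M.
  by field; rewrite gt_eqF.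
rewrite ler_pdivrMr// -ler_pdivrMl//; near: M; exact: near_ln_ge.
Unshelve. all: by end_near. Qed.

Definition light_tail (eta tau : R) M := [set w : T M |
  \sum_(x : 'I_M | eta < `|kap M * V M x w|) 1 <= tau * M%:R].

(** As [kappa] tends to 0, the threshold [eta / kappa] passes any fixed Gaussian quantile, so the
    expected fraction of such sites tends to 0. *)
Lemma whp_light_tail (eta tau : R) : 0 < eta -> 0 < tau ->
  whp P (light_tail eta tau).
Proof.
move=> eta0 tau0.
pose A M (x : 'I_M) : set (T M) :=
  ~` (V M x @^-1` `[(- (eta / kap M))%R, eta / kap M]).
apply: (@whpS _ _ _ _ (fun M => [set w | \sum_(x : 'I_M)
    (tau * M%:R)^-1 * \1_(A M x) w < 1])).
  near=> M => w /=.
  have l0 : 0 < ell M by near: M; apply: filterS (near_ln_ge (R:=R) 1) => M; exact: lt_le_trans.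
  have M0 : 0 < M%:R :> R by rewrite ltr0n; near: M; exact: nbhs_infty_gt.
  have k0 : 0 < kap M := kappa_gt0 lambda0 l0.
  rewrite -mulr_sumr mulrC ltr_pdivrMr ?mulr_gt0// mul1r => /ltW; apply: le_trans.
  rewrite big_mkcond /=; apply: ler_sum => x _.
  rewrite indicE; case: ifP => // h; rewrite mem_set//.
  rewrite /A /= in_itv /= -ler_norml ler_pdivlMr//; apply/negP.
  by rewrite -ltNge mulrC -{1}(gtr0_norm k0) -normrM.
apply: whp_markov => eps e0.
have et0 : 0 < eps * tau by rewrite mulr_gt0.
have [v0 v00 hv0] := gaussian_tail et0.
have ev0 : 0 < eta / v0 by rewrite divr_gt0.
near=> M.
have M2 : (2 <= M)%N by near: M; exact: near_M_ge2.
have l0 : 0 < ell M by rewrite ln_gt0// ltr1n.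
have k0 : 0 < kap M := kappa_gt0 lambda0 l0.
have M0 : 0 < M%:R :> R by rewrite ltr0n (leq_trans _ M2).
have kv : kap M <= eta / v0 by near: M; exact: (near_kappa_le lambda0 ev0).
split=> [x|x|].
- by apply: measurableC; rewrite -[X in measurable X]setTI; exact: measurable_funPT.
- by rewrite invr_ge0 ltW// mulr_gt0.
exists (fun=> eps * tau).
  move=> x; apply: hv0; first exact: hgauss.
  by rewrite ler_pdivlMr// mulrC -ler_pdivlMr.
rewrite sum_const_card card_ord.
have -> : M%:R * ((tau * M%:R)^-1 * (eps * tau)) = eps.
  by field; rewrite !gt_eqF.
by [].
Unshelve. all: by end_near. Qed.

Definition light_shells (L tau : R) M := [set w : T M |
  \sum_(x : 'I_M | (L < `|om M w x|) && (`|kap M * V M x w - EM M| <= `|E| / 4))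
    `|om M w x|^-1 <= tau * (M%:R * Del M)].

(** Shell k has weight exp(-k) / L and width of order exp(k + 1) L, so all O(ln M) shells contribute
    equally. Their number and the factor 1 / kappa cost at most two powers of ln M, which the small
    density in this energy range pays for. *)
Lemma whp_light_shells (L tau : R) : `|E| / 4 <= L -> 0 < tau ->
  whp P (light_shells L tau).
Proof.
move=> LE tau0; have E4 : 0 < `|E| / 4 by rewrite divr_gt0// normr_gt0.
have L0 : 0 < L := lt_le_trans E4 LE.
have b0 : 0 < (E / lambda) ^+ 2.
  rewrite lt_neqAle sqr_ge0 andbT eq_sym expf_eq0/=.
  by apply: mulf_neq0 => //; rewrite invr_eq0 gt_eqF.
pose K M := (Num.truncn (ell M)).+1.
(* Truncating at |E| / 4 / Delta keeps every shell in the energy range where the density bound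
   holds. *)
pose h M (k : nat) : R := Num.min (expR k.+1%:R * L) (`|E| / 4 / Del M).
pose A M (i : 'I_M * 'I_(K M)) : set (T M) :=
  [set w | (- h M i.2 <= om M w i.1 <= h M i.2)%R].
pose c M (i : 'I_M * 'I_(K M)) : R :=
  (tau * (M%:R * Del M))^-1 * (expR (- i.2%:R) / L).
apply: (@whpS _ _ _ _ (fun M => [set w | \sum_i c M i * \1_(A M i) w < 1])).
  near=> M => w /=.
  have l0 : 0 < ell M by near: M; apply: filterS (near_ln_ge (R:=R) 1) => M; exact: lt_le_trans.
  have M0 : 0 < M%:R :> R by rewrite ltr0n; near: M; exact: nbhs_infty_gt.
  have D0 : 0 < Del M := Delta_gt0 EM lambda0 l0.
  have Q1 : 1 <= M%:R * Del M.
    have : ell M ^+ 0 * expR (0 * ell M) <= 1 * (M%:R * Del M).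
      by near: M; exact: (near_Q_ge lambda0 hEM 0 b0 ltr01).
    by rewrite expr0 mul0r expR0 !mul1r.
  rewrite /c; under eq_bigr do rewrite -mulrA.
  have Q0 : 0 < tau * (M%:R * Del M) by apply: mulr_gt0 => //; exact: mulr_gt0.
  rewrite -mulr_sumr mulrC ltr_pdivrMr// [_ * (tau * _)]mul1r => /ltW; apply: le_trans.
  rewrite -(pair_bigA _ (fun (x : 'I_M) (k : 'I_(K M)) => expR (- k%:R) / L * \1_(A M (x, k)) w)) /=.
  rewrite big_mkcond /=; apply: ler_sum => x _.
  have c0 k : 0 <= expR (- k%:R) / L by rewrite divr_ge0 ?expR_ge0// ltW.
  case: ifP => [/andP[Lo oE]|_]; last by apply: sumr_ge0 => k _; rewrite mulr_ge0.
  have oD : `|om M w x| <= `|E| / 4 / Del M.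
    rewrite /omega /rescale normrM normfV (gtr0_norm D0) ler_pM2r ?invr_gt0//.
  (* The shells reach beyond M L, and |E| / 4 / Delta <= M L because M [Delta] >= 1 and |E| / 4 <=
     L. *)
  have oK : `|om M w x| <= expR (K M)%:R * L.
    apply: (le_trans oD); rewrite ler_pdivrMr//.
    apply: (@le_trans _ _ (L * (M%:R * Del M))).
      by apply: (le_trans LE); rewrite ler_peMr// ltW.
    rewrite mulrCA mulrA ler_pM2r// ler_pM2r// -[leLHS](lnK (x := M%:R)) ?posrE//.
    by rewrite ler_expR ltW// truncnS_gt.
  apply: (le_trans (inv_le_shells L0 _)); first by rewrite Lo; exact: oK.
  apply: ler_sum => k _; rewrite indicE; case: ifP => ok; last by rewrite mulr_ge0.
  rewrite mem_set ?mulr1// /A /= -ler_norml /h le_min ok.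
  exact: oD.
apply: whp_markov => eps e0.
(* Chosen so that the final bound 8 e1 exp(1) / (tau lambda) is exactly eps. *)
pose e1 := eps * tau * lambda / (8 * expR 1).
have e10 : 0 < e1 by rewrite divr_gt0 ?mulr_gt0 ?expR_gt0.
near=> M.
have M2 : (2 <= M)%N by near: M; exact: near_M_ge2.
have l1 : 1 <= ell M by near: M; exact: near_ln_ge.
have l0 : 0 < ell M := lt_le_trans ltr01 l1.
have k0 : 0 < kap M := kappa_gt0 lambda0 l0.
have D0 : 0 < Del M := Delta_gt0 EM lambda0 l0.
have M0 : 0 < M%:R :> R by rewrite ltr0n (leq_trans _ M2).
have hpdf : forall y, `|y - EM M| <= `|E| / 4 ->
    ell M ^+ 2 * normal_pdf 0 1 (y / kap M) <= e1.
  by near: M; exact: (near_pdf_far lambda0 hEM 2 E0 e10).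
have h0 k : 0 <= h M k.
  rewrite /h le_min; apply/andP; split.
    exact: mulr_ge0 (expR_ge0 _) (ltW L0).
  exact: divr_ge0 (ltW E4) (ltW D0).
have c0 (i : 'I_M * 'I_(K M)) : 0 <= c M i.
  apply: mulr_ge0; last by apply: divr_ge0 (expR_ge0 _) (ltW L0).
  by rewrite invr_ge0 ltW//; apply: mulr_gt0 => //; exact: mulr_gt0.
split=> [[x k]|[x k]|].
- exact: measurable_omega_itv.
- exact: c0.
exists (fun i : 'I_M * 'I_(K M) => e1 / ell M ^+ 2 * (Del M * (h M i.2 - - h M i.2) / kap M)).
  move=> [x k] /=; apply: omega_ball => //; first by have := h0 k; lra.
  move=> z; rewrite -ler_norml => hz; rewrite ler_pdivlMr ?exprn_gt0// mulrC.
  apply: hpdf; rewrite addrAC subrr add0r normrM (gtr0_norm D0) mulrC -ler_pdivlMr//.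
  by apply: (le_trans hz); rewrite ge_min lexx orbT.
have KL : (K M)%:R <= 2 * ell M.
  have -> : (K M)%:R = (Num.truncn (ell M))%:R + 1 :> R by rewrite natr1.
  have : (Num.truncn (ell M))%:R <= ell M.
    by rewrite truncn_le// ltW.
  lra.
apply: (@le_trans _ _ (\sum_(i : 'I_M * 'I_(K M))
    2 * e1 * expR 1 / (tau * M%:R * ell M ^+ 2 * kap M))).
  apply: ler_sum => -[x k] _; rewrite /c /=.
  apply: (@le_trans _ _ ((tau * (M%:R * Del M))^-1 * (expR (- k%:R) / L) *
     (e1 / ell M ^+ 2 * (Del M * (2 * (expR k.+1%:R * L)) / kap M)))).
    apply: ler_wpM2l.
      exact: (c0 (x, k)).
    apply: ler_wpM2l; first by apply: divr_ge0 (ltW e10) (sqr_ge0 _).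
    rewrite ler_pM2r ?invr_gt0// ler_pM2l//.
    have : h M k <= expR k.+1%:R * L by rewrite /h ge_min lexx.
    lra.
  have -> : expR k.+1%:R = expR k%:R * expR 1 :> R by rewrite -expRD natr1.
  rewrite expRN le_eqVlt; apply/orP; left; apply/eqP.
  by field; rewrite !gt_eqF ?expR_gt0.
rewrite sum_const_card card_prod !card_ord natrM.
have -> : M%:R * (K M)%:R * (2 * e1 * expR 1 / (tau * M%:R * ell M ^+ 2 * kap M)) =
  (K M)%:R * (2 * e1 * expR 1 / (tau * ell M ^+ 2)) * (kap M)^-1.
  by field; rewrite !gt_eqF.
have kge := kappa_ge lambda0 l1.
apply: (@le_trans _ _ (2 * ell M * (2 * e1 * expR 1 / (tau * ell M ^+ 2)) *
    (lambda / (2 * ell M))^-1)).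
  have cc : 0 <= 2 * e1 * expR 1 / (tau * ell M ^+ 2).
    by rewrite ltW// divr_gt0 ?mulr_gt0 ?expR_gt0 ?exprn_gt0.
  apply: ler_pM.
  - exact: mulr_ge0 (ler0n _ _) cc.
  - by rewrite invr_ge0 ltW.
  - exact: ler_wpM2r.
  by rewrite lef_pV2 ?posrE// divr_gt0// mulr_gt0.
rewrite /e1 le_eqVlt; apply/orP; left; apply/eqP.
by field; rewrite !gt_eqF ?expR_gt0.
Unshelve. all: by end_near. Qed.

End GoodEvents.

(** * The good event and its spectral consequences *)

Section GoodEvent.
Context {R : realType} (d : nat -> measure_display).
Context (T : forall M, measurableType (d M)) (P : forall M, probability (T M) R).
Variable V : forall M, 'I_M -> {RV (P M) >-> R}.
Arguments V : clear implicits.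
Variables (lambda : R) (EM : nat -> R) (E : R).
Hypotheses (lambda0 : 0 < lambda) (hEM : EM M @[M --> \oo] --> E).
Hypotheses (E0 : E != 0) (Em1 : E != -1) (E1 : (E / lambda) ^+ 2 < 1).
Local Notation ell M := (ln (M%:R : R)).
Local Notation Del M := (Delta lambda M (EM M)).
Local Notation Q M := (M%:R * Del M).
Local Notation om M w x := (omega lambda (EM M) (fun y => V M y w) x).

(* Far from the window the secular sum is about -Q/E, so it misses the level Q by
   about [gap * Q]; the excluded energy E = -1 is where this gap closes. *)
Definition gap : R := 1 + 1 / E.
(** The part 2 W + 2 makes |u| at most half of any far |omega|; the summand |E| gives the lower
    bound |E| / 4 required by the shell estimate. *)
Definition cutoff (W : R) : R := 2 * W + 2 + `|E|.

(** These are the hypotheses on the resolvent sums in the shape used above, with [delta] equal to 1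
    / ln M; hence the double inverse. *)
Definition good (W : R) M (w : T M) := [/\
  \sum_(x : 'I_M | `|om M w x| <= cutoff W) 1 <= (ell M)^-1^-1,
  forall x y : 'I_M, `|om M w x| <= cutoff W -> `|om M w y| <= cutoff W ->
    x != y -> (ell M)^-1 < `|om M w x - om M w y|,
  forall u, `|u| <= W ->
    `|\sum_(x | ~~ (`|om M w x| <= cutoff W)) 1 / (om M w x - u)
       - (1 - gap) * Q M| <= `|gap| / 2 * Q M &
  forall u, `|u| <= W ->
    \sum_(x | ~~ (`|om M w x| <= cutoff W)) (1 / (om M w x - u)) ^+ 2
      <= (`|E|^-1 + `|gap| / 2) * Q M].

Lemma gap_neq0 : gap != 0.
Proof.
apply/eqP => h; move/eqP: Em1; apply.
have -> : E = gap * E - 1 by rewrite /gap; field.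
by rewrite h mul0r sub0r.
Qed.

Lemma whp_good (W : R) :
  (forall M, (2 <= M)%N -> mutually_independent (V M)) ->
  (forall M, (2 <= M)%N -> forall x, standard_gaussian (V M x)) ->
  0 <= W -> whp P (fun M => [set w | good W w]).
Proof.
move=> hindep hgauss W0.
have En0 : 0 < `|E| by rewrite normr_gt0.
have g0 : 0 < `|gap| by rewrite normr_gt0 gap_neq0.
(* [eta] and [tau] are tuned so that the bulk error and the two other errors are each at most |gap|
   / 4. *)
pose eta := Num.min (`|E| / 4) (`|gap| * E ^+ 2 / 16).
pose tau := `|gap| / 4 / (9 / `|E| + 2).
have E2 : 0 < E ^+ 2 by rewrite -(real_normK (num_real E)) exprn_gt0.
have eta0 : 0 < eta by rewrite lt_min !divr_gt0// mulr_gt0.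
have c0 : 0 < 9 / `|E| + 2 by rewrite addr_gt0// divr_gt0.
have tau0 : 0 < tau by rewrite divr_gt0// divr_gt0.
have etaE : eta <= `|E| / 4 by rewrite ge_min lexx.
have ferr : far_error E eta tau <= `|gap| / 2.
  have h1 : 4 * eta / E ^+ 2 <= `|gap| / 4.
    rewrite ler_pdivrMr//.
    have : eta <= `|gap| * E ^+ 2 / 16 by rewrite ge_min lexx orbT.
    lra.
  have h2 : 9 / `|E| * tau + 2 * tau = `|gap| / 4.
    by rewrite -mulrDl /tau mulrC divfK// gt_eqF.
  by rewrite /far_error -addrA h2; lra.
have eta2 : 0 < eta / 2 by rewrite divr_gt0.
have L0 : 0 <= cutoff W by rewrite /cutoff !addr_ge0// mulr_ge0.
have LE : `|E| / 4 <= cutoff W by rewrite /cutoff; lra.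
have W1 : 0 < W + 1 by rewrite ltr_wpDl.
have LW0 : 0 < cutoff W + 1 by rewrite ltr_wpDl.
have dW : 0 < eta / 2 / (W + 1) by rewrite divr_gt0.
have dL : 0 < `|E| / 4 / (cutoff W + 1) by rewrite !divr_gt0.
apply: whpS; last first.
  exact: (whpI (whpI (whp_few_near hgauss lambda0 hEM E1 L0)
       (whp_separated hindep hgauss lambda0 hEM E1 L0))
     (whpI (whp_light_tail hgauss lambda0 eta0 tau0)
       (whp_light_shells hgauss lambda0 hEM E0 LE tau0))).
near=> M => w [[few sep] [tail shells]].
have l1 : 1 <= ell M by near: M; exact: near_ln_ge.
have l0 : 0 < ell M := lt_le_trans ltr01 l1.
have D0 : 0 < Del M := Delta_gt0 EM lambda0 l0.
have Q0 : 0 <= Q M by rewrite mulr_ge0// ltW.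
have eE : `|EM M - E| <= eta / 2 by near: M; exact: near_EM.
have DW' : ell M ^+ 0 * Del M <= eta / 2 / (W + 1).
  by near: M; exact: (near_Delta_le lambda0 hEM 0 E1 dW).
have DL' : ell M ^+ 0 * Del M <= `|E| / 4 / (cutoff W + 1).
  by near: M; exact: (near_Delta_le lambda0 hEM 0 E1 dL).
have DW : Del M * W <= eta / 2.
  move: DW'; rewrite expr0 mul1r ler_pdivlMr// mulrDr; lra.
have LD : cutoff W * Del M <= `|E| / 4.
  move: DL'; rewrite expr0 mul1r ler_pdivlMr// mulrDr [cutoff W * _]mulrC; lra.
have LW : 2 * W + 2 <= cutoff W by rewrite /cutoff; lra.
have tail' : \sum_(x : 'I_M | eta < `|kappa lambda M * V M x w|) 1
    <= tau * #|'I_M|%:R by rewrite card_ord.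
have shells' : \sum_(x : 'I_M | (cutoff W < `|om M w x|) &&
    (`|kappa lambda M * V M x w - EM M| <= `|E| / 4)) `|om M w x|^-1
    <= tau * (#|'I_M|%:R * Del M) by rewrite card_ord.
split => [|//|u uW|u uW]; first by rewrite invrK.
  have := far_sum_approx D0 E0 eta0 etaE eE DW LW W0 LD tail' shells' uW.
  rewrite card_ord /gap => h.
  have -> : (1 - (1 + 1 / E)) * Q M = - (Q M / E) by field.
  by rewrite opprK; apply: le_trans h _; exact: ler_wpM2r.
have := far_sum_sqr D0 E0 eta0 etaE eE DW LW W0 LD tail' shells' uW.
rewrite card_ord => h; apply: le_trans h _.
by apply: ler_wpM2r => //; rewrite lerD2l.
Unshelve. all: by end_near. Qed.

(** An eigenvalue is within O(ln M / Q) of a potential value, and a potential value within 1 / (2 ln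
    M) of an eigenvalue. The extra 1 in [W + 1] is the margin needed to construct a root next to a
    potential value. *)
Lemma near_good_windows (W eps : R) : 0 < eps -> 0 <= W ->
  \forall M \near \oo, forall w : T M, good (W + 1) w ->
    close_in_window W eps
      (rescaled_eigenvalues lambda (EM M) (fun x => V M x w))
      (rescaled_potential_values lambda (EM M) (fun x => V M x w)) /\
    close_in_window W eps
      (rescaled_potential_values lambda (EM M) (fun x => V M x w))
      (rescaled_eigenvalues lambda (EM M) (fun x => V M x w)).
Proof.
move=> e0 W0; have b0 : 0 < (E / lambda) ^+ 2.
  rewrite lt_neqAle sqr_ge0 andbT eq_sym expf_eq0/=.
  by apply: mulf_neq0 => //; rewrite invr_eq0 gt_eqF.
have g0 : 0 < `|gap| by rewrite normr_gt0 gap_neq0.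
have e4 : 0 < eps * `|gap| / 4 by rewrite divr_gt0 ?mulr_gt0.
have e8 : 0 < `|gap| / 8 by rewrite divr_gt0.
near=> M => w [few sep far1 far2].
have M0 : (0 < M)%N by near: M; exact: nbhs_infty_gt.
have l1 : 1 <= ell M by near: M; exact: near_ln_ge.
have le : eps^-1 <= ell M by near: M; exact: near_ln_ge.
have l0 : 0 < ell M := lt_le_trans ltr01 l1.
have D0 : 0 < Del M := Delta_gt0 EM lambda0 l0.
have D0' : Del M != 0 by rewrite gt_eqF.
have M0R : 0 < M%:R :> R by rewrite ltr0n.
have Q0 : 0 < Q M := mulr_gt0 M0R D0.
have q1 : ell M ^+ 1 * expR (0 * ell M) <= eps * `|gap| / 4 * Q M.
  by near: M; exact: (near_Q_ge lambda0 hEM 1 b0 e4).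
have q2 : ell M ^+ 2 * expR (0 * ell M) <= `|gap| / 8 * Q M.
  by near: M; exact: (near_Q_ge lambda0 hEM 2 b0 e8).
rewrite mul0r expR0 mulr1 expr1 in q1; rewrite mul0r expR0 mulr1 in q2.
have dl0 : 0 < (ell M)^-1 by rewrite invr_gt0.
have dl1 : (ell M)^-1 <= 1 by rewrite invf_le1.
have WL : W + 1 + 1 <= cutoff (W + 1) by have := normr_ge0 E; rewrite /cutoff; lra.
split=> [u [a ea <-] uW | o [n _ <-] nW].
  have {}uW : `|rescale lambda M (EM M) a| <= W by rewrite ler_norml.
  have uW1 : `|rescale lambda M (EM M) a| <= W + 1 by lra.
  have uL : `|rescale lambda M (EM M) a| <= cutoff (W + 1) by lra.
  (* Separation forbids two sites with the same value u in the window, so the eigenvalue solves the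
     secular equation. *)
  have [x y xu yu|_ hs] := secular_of_eigenvalue M0 D0' _ ea.
    apply/eqP; apply: contraT => xy.
    by have := sep x y; rewrite xu yu subrr normr0 ltNge (ltW dl0) => /(_ uL uL xy).
  have [n nn hn] := secular_root_close dl0 Q0 gap_neq0 few far1 uW1 hs.
  exists (om M w n); first by exists n.
  rewrite distrC; apply: le_trans hn _.
  rewrite ler_pdivrMr; last exact: mulr_gt0 (mulr_gt0 dl0 g0) Q0.
  have -> : eps * ((ell M)^-1 * `|gap| * Q M) =
     4 * (eps * `|gap| / 4 * Q M / ell M) by field; rewrite gt_eqF.
  have : 1 <= eps * `|gap| / 4 * Q M / ell M by rewrite ler_pdivlMr// mul1r.
  lra.
have {}nW : `|om M w n| <= W + 1 - 1 by rewrite addrK ler_norml.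
have hQ : 2 / (ell M)^-1 ^+ 2 < `|gap| / 2 * Q M.
  rewrite exprVn invrK; have := mulr_gt0 g0 Q0; lra.
have [u [un nu hs]] :=
  secular_root_exists dl0 dl1 WL gap_neq0 few sep far1 nW hQ.
exists u; first exact: eigenvalue_of_secular.
rewrite distrC; apply: (le_trans un).
have : (ell M)^-1 <= eps by rewrite -[eps]invrK lef_pV2 ?posrE ?invr_gt0.
lra.
Unshelve. all: by end_near. Qed.

(** With t = 4 ln M / (|gap| Q) the distance bound to the nearest pole, the off-pole squares are at
    most t^2 (4 + C) Q times the square of the entry at the pole, which is a constant times (ln M)^2
    / Q. The loss gamma in the exponent absorbs (ln M)^2. *)
Lemma near_good_eigenfunctions (W gamma : R) : 0 < gamma -> 0 <= W ->
  \forall M \near \oo, forall w : T M, good (W + 1) w ->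
    let v := fun x => V M x w in
    forall a : R, eigenvalue (hamiltonian lambda v) a ->
    let u := rescale lambda M (EM M) a in
    `|u| <= W ->
    let f := psi lambda (EM M) v u in
    is_eigenfunction lambda v a f /\
    1 <= norm2 f / norm_infty f
      <= 1 + 16 * (4 + (`|E|^-1 + `|gap| / 2)) / gap ^+ 2 *
             (1 / M%:R `^ ((E / lambda) ^+ 2 * (1 - gamma))).
Proof.
move=> gam0 W0; have b0 : 0 < (E / lambda) ^+ 2.
  rewrite lt_neqAle sqr_ge0 andbT eq_sym expf_eq0/=.
  by apply: mulf_neq0 => //; rewrite invr_eq0 gt_eqF.
have g0 : 0 < `|gap| by rewrite normr_gt0 gap_neq0.
have e8 : 0 < `|gap| / 8 by rewrite divr_gt0.
have bg : (E / lambda) ^+ 2 * (1 - gamma) < (E / lambda) ^+ 2.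
  by rewrite mulrBr mulr1 ltrBlDr ltrDl mulr_gt0.
near=> M => w [few sep far1 far2] a ea uW.
set u := rescale _ _ _ _ in uW *; set f := psi _ _ _ _.
have M0 : (0 < M)%N by near: M; exact: nbhs_infty_gt.
have l1 : 1 <= ell M by near: M; exact: near_ln_ge.
have l0 : 0 < ell M := lt_le_trans ltr01 l1.
have D0 : 0 < Del M := Delta_gt0 EM lambda0 l0.
have D0' : Del M != 0 by rewrite gt_eqF.
have M0R : 0 < M%:R :> R by rewrite ltr0n.
have Q0 : 0 < Q M := mulr_gt0 M0R D0.
have q2 : ell M ^+ 2 * expR (0 * ell M) <= `|gap| / 8 * Q M.
  by near: M; exact: (near_Q_ge lambda0 hEM 2 b0 e8).
(* Lets the near contribution 4 (ln M)^3 to the off-pole squares be absorbed into 4 Q. *)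
have q3 : ell M ^+ 3 * expR (0 * ell M) <= 1 * Q M.
  by near: M; exact: (near_Q_ge lambda0 hEM 3 b0 ltr01).
rewrite mul0r expR0 mulr1 in q2; rewrite mul0r expR0 mulr1 mul1r in q3.
have q4 : ell M ^+ 2 * expR ((E / lambda) ^+ 2 * (1 - gamma) * ell M) <= 1 * Q M.
  by near: M; exact: (near_Q_ge lambda0 hEM 2 bg ltr01).
have dl0 : 0 < (ell M)^-1 by rewrite invr_gt0.
have dl1 : (ell M)^-1 <= 1 by rewrite invf_le1.
have WL : W + 1 + 1 <= cutoff (W + 1) by have := normr_ge0 E; rewrite /cutoff; lra.
have uW1 : `|u| <= W + 1 by lra.
have uL : `|u| <= cutoff (W + 1) by lra.
have [x y xu yu|hu hs] := secular_of_eigenvalue M0 D0' _ ea.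
  apply/eqP; apply: contraT => xy.
  by have := sep x y; rewrite xu yu subrr normr0 ltNge (ltW dl0) => /(_ uL uL xy).
split; first exact: secular_eigenfunction.
have [n nn hn] := secular_root_close dl0 Q0 gap_neq0 few far1 uW1 hs.
set t := 4 / _ in hn.
have tE : t = 4 * ell M / (`|gap| * Q M) by rewrite /t; field; rewrite !gt_eqF.
have t2 : t <= (ell M)^-1 / 2.
  rewrite tE ler_pdivrMr; last exact: mulr_gt0 g0 Q0.
  have -> : (ell M)^-1 / 2 * (`|gap| * Q M) = 4 * (`|gap| / 8 * Q M / ell M).
    by field; rewrite gt_eqF.
  by rewrite ler_pM2l// ler_pdivlMr// -expr2.
have hC := off_root_sqr_sum dl0 few sep far2 nn uW1 (le_trans hn t2).
set C := `|E|^-1 + _ in hC *.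
have C0 : 0 <= C by rewrite addr_ge0 ?invr_ge0// divr_ge0.
have z0 : om M w n - u != 0 by rewrite subr_eq0; exact: hu.
have fn : f ord0 n = 1 / (om M w n - u) by rewrite mxE.
have z2 : 0 < (om M w n - u) ^+ 2 by rewrite -(real_normK (num_real _)) exprn_gt0// normr_gt0.
have zt : (om M w n - u) ^+ 2 <= t ^+ 2.
  rewrite -(real_normK (num_real _)) ler_sqr ?nnegrE//.
  exact: le_trans hn.
have /andP[r1 r2] : 1 <= norm2 f / norm_infty f <= 1 + t ^+ 2 * ((4 + C) * Q M).
  apply: (norm_ratio_le (x := n)).
    by rewrite fn mul1r invr_neq0.
  rewrite fn; under eq_bigr do rewrite mxE.
  apply: (le_trans hC); rewrite mulrAC mul1r -[leLHS]mul1r.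
  apply: ler_pM => //.
  - apply: addr_ge0 (mulr_ge0 C0 (ltW Q0)).
    by apply: divr_ge0 => //; rewrite exprn_ge0// ltW.
  - by rewrite exprVn ler_pdivlMr// mul1r.
  by rewrite exprVn invrK [leRHS]mulrDl lerD2r ler_pM2l.
rewrite r1 /=; apply: (le_trans r2); rewrite lerD2l.
have -> : t ^+ 2 * ((4 + C) * Q M) = 16 * (4 + C) / gap ^+ 2 * (ell M ^+ 2 / Q M).
  rewrite tE -(real_normK (num_real gap)); field.
  by rewrite !gt_eqF.
apply: ler_wpM2l.
  by rewrite divr_ge0 ?sqr_ge0// mulr_ge0// addr_ge0.
rewrite /powR pnatr_eq0 gtn_eqF// ler_pdivrMr//.
rewrite mul1r mulrC ler_pdivlMr ?expR_gt0//; move: q4; rewrite mul1r; exact.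
Unshelve. all: by end_near. Qed.

End GoodEvent.

Theorem theorem6p3 (R : realType)
    (d : nat -> measure_display) (T : forall M, measurableType (d M))
    (P : forall M, probability (T M) R)
    (V : forall M, 'I_M -> {RV (P M) >-> R})
    (hindep : forall M, (2 <= M)%N -> mutually_independent (V M))
    (hgauss : forall M, (2 <= M)%N -> forall x, standard_gaussian (V M x))
    (lambda : R) (hlambda : 0 < lambda)
    (EM : nat -> R) (E : R) (hEM : EM M @[M --> \oo] --> E)
    (hElambda : - lambda < E < lambda) (hEm1 : E != -1) (hE0 : E != 0) :
  (forall W eps : R, 0 < eps ->
    with_probability_tending_to_1 P (fun M => [set w |
      let v := fun x => V M x w in
      close_in_window W eps (rescaled_eigenvalues lambda (EM M) v)
                            (rescaled_potential_values lambda (EM M) v) /\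
      close_in_window W eps (rescaled_potential_values lambda (EM M) v)
                            (rescaled_eigenvalues lambda (EM M) v)]))
  /\
  (forall W gamma : R, 0 < gamma ->
    exists C1 C2 : R,
    with_probability_tending_to_1 P (fun M => [set w |
      let v := fun x => V M x w in
      forall a : R, eigenvalue (hamiltonian lambda v) a ->
        let u := rescale lambda M (EM M) a in
        `|u| < W ->
        let f := psi lambda (EM M) v u in
        is_eigenfunction lambda v a f /\
        1 <= norm2 f / norm_infty f
          <= 1 + C1 * (1 / M%:R `^ ((E / lambda) ^+ 2 * (1 - gamma)))
               + C2 * (1 / M%:R `^ (1 / 2 - gamma))])).
Proof.
have E0l : (E / lambda) ^+ 2 < 1.
  rewrite exprMn exprVn ltr_pdivrMr ?exprn_gt0// mul1r.
  rewrite -(real_normK (num_real E)) ltr_pXn2r ?nnegrE ?(ltW hlambda)//.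
  by rewrite ltr_norml.
(* The sign of W is unrestricted, so the good event is taken for |W|, enlarged by the margin 1. *)
have hwhp (W : R) : whp P (fun M => [set w | good V lambda EM E (`|W| + 1) w]).
  by apply: whp_good => //; rewrite addr_ge0.
split=> [W eps e0|W gamma gamma0].
  apply: whp_tending_to_1; apply: (whpS _ (hwhp W)).
  near=> M => w gw.
  have h : forall w : T M, good V lambda EM E (`|W| + 1) w ->
      close_in_window `|W| eps
        (rescaled_eigenvalues lambda (EM M) (fun x => V M x w))
        (rescaled_potential_values lambda (EM M) (fun x => V M x w)) /\
      close_in_window `|W| eps
        (rescaled_potential_values lambda (EM M) (fun x => V M x w))
        (rescaled_eigenvalues lambda (EM M) (fun x => V M x w)).
    near: M; exact: (near_good_windows V hlambda hEM hE0 hEm1 e0 (normr_ge0 W)).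
  have mono U O : close_in_window `|W| eps U O -> close_in_window W eps U O.
    move=> hUO u Uu /andP[u1 u2]; apply: hUO => //.
    by have := ler_norm W; rewrite -ler_norml ler_norml; lra.
  by have [h1 h2] := h w gw; split; exact: mono.
exists (16 * (4 + (`|E|^-1 + `|gap E| / 2)) / gap E ^+ 2), 0.
apply: whp_tending_to_1; apply: (whpS _ (hwhp W)).
  near=> M => w gw /= a ea uW.
rewrite mul0r addr0; move: w gw a ea uW; near: M.
have := near_good_eigenfunctions V hlambda hEM hE0 hEm1 gamma0 (normr_ge0 W).
apply: filterS => M h w gw a ea uW; apply: h => //.
exact: le_trans (ltW uW) (ler_norm W).
Unshelve. all: by end_near. Qed.
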